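(* Let $\mathcal{G}=(V,E)$ be a finite connected simple graph with $|V|\geq2$, and let $\mathfrak{X}$ be an embedding of $\mathcal{G}$ in $\mathbb{R}^2$ with straight-line edges, equipped with the scaled graph metric $d$ described in the context. Suppose that $\mu$ is a probability measure on $\mathfrak{X}$ having density $f$ with respect to uniform probability on $\mathfrak{X}$ such that $c\leq f(x)\leq C$ for every $x\in\mathfrak{X}$, where $0<c\leq C<\infty$. Given $\alpha\in(0,\infty)$, let $$r(n)\equiv r(n,c,\alpha):=4c^{-1}\sqrt{(2+\alpha)\frac{\ln n}{n}}.$$ Then there is $n_0\equiv n_0(c,C,\alpha)$, depending only on $c$, $C$, $\alpha$, such that $n\geq n_0$ implies that $(\mathfrak{X},d,\mu)$ is $\left(n,\,[|E|(|E|-1)]^{|E|-1}n^{-\alpha},\,r(n)\right)$-disintegrable (with $0^0$ interpreted as $1$).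
   Context: $\mathbb{N}=\{1,2,\dots\}$ and $[n]=\{1,\dots,n\}$. A metric Polish probability space $(\mathfrak{X},d,\mu)$ consists of a Polish space $\mathfrak{X}$, a (not necessarily complete) metric $d$ generating its topology, and a Borel probability measure $\mu$. $B(x,r)=\{y\in\mathfrak{X}: d(x,y)\leq r\}$ is the closed ball. Given $n\in\mathbb{N}$, $\epsilon>0$, $r>0$, $(\mathfrak{X},d,\mu)$ is $(n,\epsilon,r)$-disintegrable if, whenever $X_1,\dots,X_n$ are i.i.d. with distribution $\mu$ on a probability space $(\Psi,\mathcal{F},\mathbb{P})$, with $\mathbb{P}$-probability at least $1-\epsilon$ (i.e. on some event of probability at least $1-\epsilon$) there exists a disintegration of $\mu$ along the random multifunction $x\mapsto\{i\in[n]: x\in B(X_i,r)\}$ with respect to the uniform measure on $[n]$; that is, there exist Borel probability measures $\mu_1,\dots,\mu_n$ on $\mathfrak{X}$ with $\mu_i(B(X_i,r))=1$ for all $i$ and $\mu=\frac1n\sum_{i=1}^n\mu_i$. Embedding and metric: without any concern for edge-crossings, $\mathcal{G}$ is embedded as $\mathfrak{X}$ in $\mathbb{R}^2$ arbitrarily using straight-line edges. Each embedded edge is regarded as having length $1/|E|$, and $d(x,y)$ is the length of the shortest path from $x$ to $y$ traversing only the embedded edges, where moves from one embedded edge to another are permitted only at the embedded vertices $v\in V$ (so points of distinct edges that happen to cross in the plane other than at a common vertex are treated as distinct points of $\mathfrak{X}$). Thus $d$ extends graph distance scaled by the factor $1/|E|$. The uniform probability on $\mathfrak{X}$ is length measure,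 giving mass $1/|E|$ to each edge. *)

(* Defs.v *)
From HB Require Import structures.
From mathcomp Require Import all_boot all_order all_algebra.
From mathcomp Require Import all_classical all_reals all_analysis.
From mathcomp Require Import lra.

Set Implicit Arguments.
Unset Strict Implicit.
Unset Printing Implicit Defensive.

Import Order.TTheory GRing.Theory Num.Theory.
Import numFieldNormedType.Exports.

Local Open Scope classical_set_scope.
Local Open Scope ring_scope.

(* The library endows generated sigma-algebras with a measurableType structure
   only over pointed types. *)
#[short(type="pmetricType")]
HB.structure Definition PointedMetric (R : numDomainType) :=
  { M of Metric R M & Pointed M }.

Definition borel (R : realType) (T : pmetricType R) :=
  g_sigma_algebraType (@open T).

Definition mclosed_ball (R : realType) (T : pmetricType R) (x : T) (r : R) :
  set T := [set y | mdist x y <= r].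

Definition independent_RVs (R : realType) d (Psi : measurableType d)
    (P : probability Psi R) d' (T : measurableType d') (n : nat)
    (X : 'I_n -> {RV P >-> T}) : Prop :=
  forall (J : {set 'I_n}) (B : 'I_n -> set T),
    (forall i, i \in J -> measurable (B i)) ->
    P (\bigcap_(i in [set` J]) (X i @^-1` B i)) =
    (\prod_(i in J) P (X i @^-1` B i))%E.

Definition iid (R : realType) d (Psi : measurableType d)
    (P : probability Psi R) d' (T : measurableType d') (mu : probability T R)
    (n : nat) (X : 'I_n -> {RV P >-> T}) : Prop :=
  independent_RVs X /\
  forall i B, measurable B -> distribution P (X i) B = mu B.

(* The condition itself makes no use of the Polishness of T. *)
Definition disintegrable (R : realType) (T : pmetricType R)
    (mu : probability (borel T) R) (n : nat) (eps r : R) : Prop :=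
  forall d (Psi : measurableType d) (P : probability Psi R)
      (X : 'I_n -> {RV P >-> borel T}),
    iid mu X ->
    exists A : set Psi,
      [/\ measurable A,
          ((1 - eps)%:E <= P A)%E &
          forall w, A w ->
          exists nu : 'I_n -> probability (borel T) R,
            (forall i, nu i (mclosed_ball (X i w : T) r) = 1%E) /\
            (forall B : set (borel T), measurable B ->
               mu B = ((n%:R^-1)%:E * \sum_(i < n) nu i B)%E)].

Record cgraph := CGraph {
  vertex :> finType;
  adj : rel vertex;
  adj_sym : symmetric adj;
  adj_irrefl : irreflexive adj;
  adj_connected : forall u v, connect adj u v;
  vertex_gt1 : (1 < #|vertex|)%N }.

(* Each unordered pair of adjacent vertices occurs exactly once, oriented by the
   enumeration of the vertices. *)
Definition edge (G : cgraph) : Type :=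
  {p : G * G | adj p.1 p.2 && (enum_rank p.1 < enum_rank p.2)%N}.
HB.instance Definition _ G := Finite.on (edge G).

Definition src (G : cgraph) (e : edge G) : G := (val e).1.
Definition tgt (G : cgraph) (e : edge G) : G := (val e).2.
Definition nb_edges (G : cgraph) : nat := #|{: edge G}|.

(* The library norm on 'rV[R]_2 is the sup norm. *)
Definition enorm (R : realType) (p : 'rV[R]_2) : R :=
  Num.sqrt (\sum_(i < 2) p 0 i ^+ 2).

Record embedding (R : realType) (G : cgraph) := Embedding {
  position :> G -> 'rV[R]_2;
  position_inj : injective position }.

Lemma src_neq_tgt (G : cgraph) (e : edge G) : src e != tgt e.
Proof.
case: e => -[u v] /= uv; rewrite /src /tgt /=.
by apply/eqP => E; move: uv; rewrite /= E ltnn andbF.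
Qed.

Lemma adj_edge (G : cgraph) (u v : G) : adj u v ->
  exists e : edge G,
    (src e = u /\ tgt e = v) \/ (src e = v /\ tgt e = u).
Proof.
move=> uv; case: (ltngtP (enum_rank u) (enum_rank v)) => ruv.
- have p : adj (u, v).1 (u, v).2 &&
    (enum_rank (u, v).1 < enum_rank (u, v).2)%N by rewrite /= uv.
  by exists (exist _ (u, v) p); left.
- have p : adj (v, u).1 (v, u).2 &&
    (enum_rank (v, u).1 < enum_rank (v, u).2)%N by rewrite /= adj_sym uv.
  by exists (exist _ (v, u) p); right.
- by move: uv; rewrite (enum_rank_inj (val_inj ruv)) adj_irrefl.
Qed.

Lemma neighbour (G : cgraph) (u : G) : exists v, adj u v.
Proof.
have [v vu] : exists v, v != u.
  have /card_gt1P[x [y [_ _ xy]]] := vertex_gt1 G.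
  have [xu|xu] := eqVneq x u; last by exists x.
  by exists y; rewrite -xu eq_sym.
have /connectP[[|w p] /= uw E] := adj_connected u v.
  by rewrite E eqxx in vu.
by exists w; case/andP: uw.
Qed.

Definition point_vertex (G : cgraph) : G :=
  enum_val (Ordinal (ltnW (vertex_gt1 G))).

Lemma nb_edges_gt0 (G : cgraph) : (0 < nb_edges G)%N.
Proof.
have [v /adj_edge[e _]] := neighbour (point_vertex G).
by rewrite /nb_edges; apply/card_gt0P; exists e.
Qed.

Section euclidean_norm.
Context (R : realType).
Implicit Types p : 'rV[R]_2.

Lemma enorm_ge0 p : 0 <= enorm p. Proof. exact: sqrtr_ge0. Qed.

Lemma enormZ a p : enorm (a *: p) = `|a| * enorm p.
Proof.
rewrite /enorm; under eq_bigr do rewrite mxE exprMn.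
by rewrite -mulr_sumr sqrtrM ?sqr_ge0// sqrtr_sqr.
Qed.

Lemma enormB p q : enorm (p - q) = enorm (q - p).
Proof. by rewrite -opprB -scaleN1r enormZ normrN1 mul1r. Qed.

Lemma enorm_eq0 p : (enorm p == 0) = (p == 0).
Proof.
apply/idP/eqP => [|->]; last first.
  by rewrite -(scale0r 0) enormZ normr0 mul0r.
rewrite sqrtr_eq0 => h; apply/rowP => i; rewrite mxE.
have s0 : \sum_(i < 2) p 0 i ^+ 2 == 0.
  by rewrite eq_le h sumr_ge0// => j _; exact: sqr_ge0.
move: s0; rewrite psumr_eq0; last by move=> j _; exact: sqr_ge0.
by move=> /allP/(_ i (mem_index_enum i)); rewrite sqrf_eq0 => /eqP.
Qed.

End euclidean_norm.

Section egraph.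
Context (R : realType) (G : cgraph) (phi : embedding R G).
Implicit Types e : edge G.

Definition edge_segment e (t : R) : 'rV[R]_2 :=
  (1 - t) *: phi (src e) + t *: phi (tgt e).

(* A point of the embedded graph is a point of the plane tagged with the vertex
   it is the image of, or with the edge in whose open segment it lies; hence
   edges meet at their common endpoints only, whatever their crossings in the
   plane. *)
Definition egraph_set : set ((G + edge G) * 'rV[R]_2) :=
  [set x | match x.1 with
           | inl v => x.2 = phi v
           | inr e => exists2 t, 0 < t < 1 & x.2 = edge_segment e t
           end].

Definition egraph : Type := {x | x \in egraph_set}.
HB.instance Definition _ := Choice.on egraph.

Definition cell (x : egraph) : G + edge G := (val x).1.
Definition pos (x : egraph) : 'rV[R]_2 := (val x).2.

Fact at_vertex_subproof v : (inl v, phi v) \in egraph_set.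
Proof. by rewrite inE. Qed.

Definition at_vertex v : egraph :=
  exist (fun x => x \in egraph_set) _ (at_vertex_subproof v).

HB.instance Definition _ := isPointed.Build egraph (at_vertex (point_vertex G)).

(* x belongs to the closed edge e. *)
Definition on_edge e (x : egraph) : bool :=
  match cell x with
  | inl v => (v == src e) || (v == tgt e)
  | inr e' => e' == e
  end.

(* Length of the segment of e between x and y, when e has length 1 / |E|. *)
Definition edge_dist e (x y : egraph) : R :=
  enorm (pos x - pos y) / enorm (phi (src e) - phi (tgt e)) / (nb_edges G)%:R.

(* A path is a concatenation of moves, each along one closed edge; consecutive
   moves share a point, so a change of edge can only occur at a vertex. *)
Inductive path_of_length : egraph -> egraph -> R -> Prop :=
| path_nil x : path_of_length x x 0
| path_cons e x y z l : on_edge e x -> on_edge e y -> path_of_length y z l ->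
    path_of_length x z (edge_dist e x y + l).

Definition graph_dist (x y : egraph) : R := inf [set l | path_of_length x y l].

Fact edge_point_subproof e t : 0 < t < 1 ->
  (inr e, edge_segment e t) \in egraph_set.
Proof. by move=> t01; rewrite inE /=; exists t. Qed.

(* The point dividing e in the ratio t : 1 - t; t is clamped to [0, 1]. *)
Definition edge_point e (t : R) : egraph :=
  match pselect (0 < t < 1) with
  | left t01 => exist (fun x => x \in egraph_set) _ (edge_point_subproof e t01)
  | right _ => if t <= 0 then at_vertex (src e) else at_vertex (tgt e)
  end.

Lemma egraph_eq (x y : egraph) : cell x = cell y -> pos x = pos y -> x = y.
Proof.
case: x y => [[a p] h] [[b q] k]; rewrite /cell /pos /= => ab pq.
by apply: val_inj; rewrite /= ab pq.
Qed.

Lemma edge_segment0 e : edge_segment e 0 = phi (src e).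
Proof. by rewrite /edge_segment subr0 scale1r scale0r addr0. Qed.

Lemma edge_segment1 e : edge_segment e 1 = phi (tgt e).
Proof. by rewrite /edge_segment subrr scale1r scale0r add0r. Qed.

Lemma edge_pointI e t : 0 < t < 1 ->
  cell (edge_point e t) = inr e /\ pos (edge_point e t) = edge_segment e t.
Proof.
by move=> t01; rewrite /edge_point; case: pselect.
Qed.

Lemma edge_point_le0 e t : t <= 0 -> edge_point e t = at_vertex (src e).
Proof.
by move=> t0; rewrite /edge_point; case: pselect => [t01|_];
   [exfalso; lra|rewrite t0].
Qed.

Lemma edge_point_ge1 e t : 1 <= t -> edge_point e t = at_vertex (tgt e).
Proof.
move=> t1; rewrite /edge_point; case: pselect => [t01|_]; first by exfalso; lra.
by rewrite leNgt (lt_le_trans ltr01).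
Qed.

Lemma pos_edge_point e t : 0 <= t <= 1 ->
  pos (edge_point e t) = edge_segment e t.
Proof.
move=> /andP[]; rewrite le_eqVlt => /predU1P[<- _|t0].
  by rewrite edge_point_le0// edge_segment0.
rewrite le_eqVlt => /predU1P[->|t1]; last by apply: (edge_pointI e _).2; lra.
by rewrite edge_point_ge1// edge_segment1.
Qed.

Lemma on_edge_point e t : on_edge e (edge_point e t).
Proof.
have [t0|t0] := leP t 0; first by rewrite edge_point_le0// /on_edge /= eqxx.
have [t1|t1] := leP 1 t.
  by rewrite edge_point_ge1// /on_edge /= eqxx orbT.
by rewrite /on_edge (edge_pointI e _).1 ?t0//.
Qed.

Lemma on_edgeP e x : on_edge e x ->
  exists2 t, 0 <= t <= 1 & x = edge_point e t.
Proof.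
case: x => -[[v|e'] p] h; rewrite /on_edge /cell /=.
  have E w : v = w ->
      exist (fun x => x \in egraph_set) (inl v, p) h = at_vertex w.
    by move=> vw; apply: egraph_eq; rewrite /cell /pos /= ?vw//; move: h;
       rewrite inE /= vw.
  move=> /orP[]/eqP/E ->.
    by exists 0; [lra|rewrite edge_point_le0].
  by exists 1; [lra|rewrite edge_point_ge1].
move=> /eqP e'e; subst e'; have := h; rewrite inE /= => -[t t01 pE].
exists t; first lra.
by have [c q] := edge_pointI e t01; apply: egraph_eq; rewrite ?c ?q.
Qed.

Lemma on_some_edge x : exists e, on_edge e x.
Proof.
case: x => -[[v|e] p] h; last by exists e; rewrite /on_edge /=.
have [w /adj_edge[e E]] := neighbour v; exists e; rewrite /on_edge /=.
by case: E => [[-> _]|[_ ->]]; rewrite eqxx ?orbT.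
Qed.

Lemma edge_len_gt0 e : 0 < enorm (phi (src e) - phi (tgt e)).
Proof.
rewrite lt_neqAle enorm_ge0 andbT eq_sym enorm_eq0 subr_eq0.
by apply: contra (src_neq_tgt e) => /eqP/(@position_inj _ _ phi) ->.
Qed.

Lemma nb_edgesR_gt0 : 0 < (nb_edges G)%:R :> R.
Proof. by rewrite ltr0n nb_edges_gt0. Qed.

Lemma edge_segmentB e s t : edge_segment e s - edge_segment e t =
  (t - s) *: (phi (src e) - phi (tgt e)).
Proof.
rewrite /edge_segment; apply/rowP => i; rewrite !mxE; lra.
Qed.

Lemma edge_dist_point e s t : 0 <= s <= 1 -> 0 <= t <= 1 ->
  edge_dist e (edge_point e s) (edge_point e t) = `|s - t| / (nb_edges G)%:R.
Proof.
move=> s01 t01; rewrite /edge_dist !pos_edge_point// edge_segmentB enormZ.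
by rewrite mulfK ?gt_eqF ?edge_len_gt0// distrC.
Qed.

Lemma edge_dist_ge0 e x y : 0 <= edge_dist e x y.
Proof. by rewrite /edge_dist !divr_ge0 ?enorm_ge0. Qed.

Lemma edge_distC e x y : edge_dist e x y = edge_dist e y x.
Proof. by rewrite /edge_dist enormB. Qed.

Lemma path_ge0 x y l : path_of_length x y l -> 0 <= l.
Proof. by elim=> // *; rewrite addr_ge0 ?edge_dist_ge0. Qed.

Lemma path_cat x y z l l' :
  path_of_length x y l -> path_of_length y z l' -> path_of_length x z (l + l').
Proof.
elim=> [{}x|e {}x w {}y {}l ex ew _ IH] h; first by rewrite add0r.
by rewrite -addrA; apply: (path_cons ex ew); exact: IH.
Qed.

Lemma path_edge e x y : on_edge e x -> on_edge e y ->
  path_of_length x y (edge_dist e x y).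
Proof.
by move=> ex ey; rewrite -[edge_dist _ _ _]addr0; apply: (path_cons ex ey);
   exact: path_nil.
Qed.

Lemma path_rev x y l : path_of_length x y l -> path_of_length y x l.
Proof.
elim=> [{}x|e {}x w {}y {}l ex ew _ IH]; first exact: path_nil.
by rewrite addrC edge_distC; apply: (path_cat IH); exact: path_edge.
Qed.

Lemma path_exists x y : exists l, path_of_length x y l.
Proof.
have vv u v : exists l, path_of_length (at_vertex u) (at_vertex v) l.
  have /connectP[p] := adj_connected u v.
  elim: p u => [|w p IH] u /=; first by move=> _ ->; exists 0; exact: path_nil.
  move=> /andP[/adj_edge[e E] wp] vE.
  have [l hl] := IH _ wp vE.
  exists (edge_dist e (at_vertex u) (at_vertex w) + l).
  by apply: path_cons hl; rewrite /on_edge /=;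
    case: E => [[-> ->]|[-> ->]]; rewrite eqxx ?orbT.
have tov z : exists v l, path_of_length z (at_vertex v) l.
  have [e ez] := on_some_edge z; exists (src e); eexists; apply: path_edge ez _.
  by rewrite /on_edge /= eqxx.
have [u [l1 h1]] := tov x; have [v [l2 h2]] := tov y; have [l h] := vv u v.
by eexists; apply: path_cat h1 (path_cat h (path_rev h2)).
Qed.

Lemma graph_dist_le x y l : path_of_length x y l -> graph_dist x y <= l.
Proof.
by move=> h; apply: ge_inf => //; exists 0 => a /= /path_ge0.
Qed.

Lemma graph_dist_ge x y a : (forall l, path_of_length x y l -> a <= l) ->
  a <= graph_dist x y.
Proof. by move=> h; apply: lb_le_inf => //; exact: path_exists. Qed.

Lemma graph_distxx x : graph_dist x x = 0.
Proof.
apply/eqP; rewrite eq_le graph_dist_le; last exact: path_nil.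
by apply: graph_dist_ge => l /path_ge0.
Qed.

Lemma graph_distC x y : graph_dist x y = graph_dist y x.
Proof.
by congr inf; apply/seteqP; split => l /path_rev.
Qed.

Lemma graph_dist_triangle y x z :
  graph_dist x z <= graph_dist x y + graph_dist y z.
Proof.
rewrite -lerBlDr; apply: graph_dist_ge => l h; rewrite lerBlDr -lerBlDl.
apply: graph_dist_ge => l' h'; rewrite lerBlDl.
exact: graph_dist_le (path_cat h h').
Qed.

(* Barycentric coordinates; x |-> bary w x is |E|-Lipschitz. *)
Definition bary (w : G) (x : egraph) : R :=
  match cell x with
  | inl v => (v == w)%:R
  | inr e =>
      let t := enorm (phi (src e) - pos x) / enorm (phi (src e) - phi (tgt e)) in
      (src e == w)%:R * (1 - t) + (tgt e == w)%:R * t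
  end.

Lemma bary_edge_point w e t : 0 <= t <= 1 ->
  bary w (edge_point e t) = (src e == w)%:R * (1 - t) + (tgt e == w)%:R * t.
Proof.
move=> /andP[]; rewrite le_eqVlt => /predU1P[<- _|t0].
  by rewrite edge_point_le0// /bary /=; lra.
rewrite le_eqVlt => /predU1P[->|t1].
  by rewrite edge_point_ge1// /bary /=; lra.
have t01 : 0 < t < 1 by lra.
have [c q] := edge_pointI e t01.
rewrite /bary c q -(edge_segment0 e) edge_segmentB subr0 enormZ edge_segment0.
by rewrite mulfK ?gt_eqF ?edge_len_gt0// gtr0_norm.
Qed.

Lemma bary_edge_dist w e x y : on_edge e x -> on_edge e y ->
  `|bary w x - bary w y| <= (nb_edges G)%:R * edge_dist e x y.
Proof.
move=> /on_edgeP[s s01 ->] /on_edgeP[t t01 ->].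
rewrite edge_dist_point// !bary_edge_point//.
rewrite [leRHS]mulrC mulfVK ?gt_eqF ?nb_edgesR_gt0//.
have [E|_] := eqVneq (src e) w; have [E'|_] := eqVneq (tgt e) w.
- by have /eqP := src_neq_tgt e; rewrite E E'.
- by rewrite /= !mul1r !mul0r !addr0 distrC;
     have -> : 1 - t - (1 - s) = s - t by lra.
- by rewrite /= !mul1r !mul0r !add0r.
- by rewrite /= !mul0r addr0 subrr normr0.
Qed.

Lemma bary_dist w x y :
  `|bary w x - bary w y| <= (nb_edges G)%:R * graph_dist x y.
Proof.
rewrite -ler_pdivrMl ?nb_edgesR_gt0//; apply: graph_dist_ge => l.
elim=> [{}x|e {}x z {}y {}l ex ez _ IH]; first by rewrite subrr normr0 mulr0.
have h : (nb_edges G)%:R^-1 * `|bary w x - bary w z| <= edge_dist e x z.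
  by rewrite ler_pdivrMl ?nb_edgesR_gt0//; exact: bary_edge_dist.
apply: le_trans (lerD h IH);
  rewrite -mulrDr ler_pM2l ?invr_gt0 ?nb_edgesR_gt0//.
exact: ler_distD.
Qed.

Lemma graph_dist_positivity x y : graph_dist x y = 0 -> x = y.
Proof.
move=> d0; have B w : bary w x = bary w y.
  apply/eqP; rewrite -subr_eq0 -normr_eq0 eq_le normr_ge0 andbT.
  by apply: le_trans (bary_dist w x y) _; rewrite d0 mulr0.
have vtx z v : cell z = inl v -> z = at_vertex v.
  case: z => -[c p] h; rewrite /cell /= => E; subst c.
  by apply: egraph_eq => //; have := h; rewrite inE.
have int z e : cell z = inr e -> exists2 t, 0 < t < 1 & z = edge_point e t.
  case: z => -[c p] h; rewrite /cell /= => E; subst c.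
  have := h; rewrite inE /= => -[t t01 pE]; exists t => //.
  by have [c q] := edge_pointI e t01; apply: egraph_eq; rewrite ?c ?q.
have vi v e t : 0 < t < 1 ->
    ~ (forall w, bary w (at_vertex v) = bary w (edge_point e t)).
  move=> t01 /(_ (src e)); rewrite bary_edge_point; last lra.
  rewrite /bary /= eqxx [tgt e == _]eq_sym (negbTE (src_neq_tgt e)).
  by case: eqP => _ /=; lra.
case Ex : (cell x) => [v|e]; case Ey : (cell y) => [v'|e'].
- move: B; rewrite (vtx _ _ Ex) (vtx _ _ Ey) => /(_ v).
  rewrite /bary /= eqxx; have [-> //|_] := eqVneq v' v.
  by move=> /eqP; rewrite oner_eq0.
- have [t t01 yE] := int _ _ Ey; exfalso; apply: (vi v e' t t01) => w.
  by rewrite -yE -(vtx _ _ Ex).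
- have [t t01 xE] := int _ _ Ex; exfalso; apply: (vi v' e t t01) => w.
  by rewrite -xE -(vtx _ _ Ey).
have [s s01 xE] := int _ _ Ex; have [t t01 yE] := int _ _ Ey.
have st : e = e' -> x = y.
  move=> ee; subst e'; have := B (src e); rewrite xE yE.
  rewrite !bary_edge_point; [|lra|lra].
  rewrite eqxx [tgt e == _]eq_sym (negbTE (src_neq_tgt e)) /= => st.
  by congr edge_point; lra.
have /orP S : (src e' == src e) || (tgt e' == src e).
  apply/negPn/negP => /norP[/negbTE h /negbTE h']; have := B (src e).
  rewrite xE yE !bary_edge_point; [|lra|lra].
  rewrite eqxx h h' [tgt e == _]eq_sym (negbTE (src_neq_tgt e)) /=; lra.
have /orP T : (src e' == tgt e) || (tgt e' == tgt e).
  apply/negPn/negP => /norP[/negbTE h /negbTE h']; have := B (tgt e).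
  rewrite xE yE !bary_edge_point; [|lra|lra].
  rewrite eqxx h h' (negbTE (src_neq_tgt e)) /=; lra.
apply: st; have := src_neq_tgt e; move: S T.
case: e e' {Ex Ey xE yE} => -[a b] /= hab [] -[a' b'] /= hab'.
rewrite /src /tgt /= => S T ab; apply: val_inj => /=.
case: S => /eqP S; case: T => /eqP T; subst.
- by rewrite eqxx in ab.
- by [].
- by move: hab hab' => /andP[_ h] /andP[_ h'];
     have := ltn_trans h h'; rewrite ltnn.
- by rewrite eqxx in ab.
Qed.

HB.instance Definition _ := @isMetric.Build R egraph graph_dist graph_distxx
  graph_dist_positivity graph_distC graph_dist_triangle.

End egraph.

Section uniform.
Context (R : realType) (G : cgraph) (phi : embedding R G).
Implicit Types e : edge G.

Let edge_point_clamp e t :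
  edge_point phi e t = edge_point phi e (Num.max 0 (Num.min 1 t)).
Proof.
have [t1|t1] := leP 1 t.
  by rewrite max_r ?ler01// !edge_point_ge1.
have [t0|t0] := leP t 0; last by [].
by rewrite !edge_point_le0.
Qed.

Lemma edge_point_lipschitz e s t :
  mdist (edge_point phi e s) (edge_point phi e t) <= `|s - t| / (nb_edges G)%:R.
Proof.
rewrite [edge_point phi e s]edge_point_clamp.
rewrite [edge_point phi e t]edge_point_clamp.
set s' := Num.max 0 _; set t' := Num.max 0 _.
have s01 : 0 <= s' <= 1.
  by rewrite /s' le_max lexx/= ge_max ler01 ge_min lexx.
have t01 : 0 <= t' <= 1.
  by rewrite /t' le_max lexx/= ge_max ler01 ge_min lexx.
have st : `|s' - t'| <= `|s - t|.
  have K (u : R) : [\/ u <= 0 /\ Num.max 0 (Num.min 1 u) = 0,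
      0 <= u <= 1 /\ Num.max 0 (Num.min 1 u) = u |
      1 <= u /\ Num.max 0 (Num.min 1 u) = 1].
    have [u1|u1] := leP 1 u; first by constructor 3; rewrite max_r ?ler01.
    have [u0|u0] := leP u 0; first by constructor 1.
    by constructor 2; split => //; lra.
  rewrite /s' /t' ler_norml.
  by case: (K s) => -[? ->]; case: (K t) => -[? ->];
    case: (ger0P (s - t)) => ?; lra.
apply: (@le_trans _ _ (`|s' - t'| / (nb_edges G)%:R)); last first.
  by rewrite ler_pM2r ?invr_gt0 ?nb_edgesR_gt0.
rewrite -(edge_dist_point phi e s01 t01).
by apply: graph_dist_le; apply: path_edge; exact: on_edge_point.
Qed.

Lemma continuous_edge_point e : continuous (edge_point phi e).
Proof.
move=> t; apply/metricType_numDomainType.cvgrPdist_lt => eps eps0.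
near=> s; apply: le_lt_trans (edge_point_lipschitz e t s) _.
rewrite ltr_pdivrMr ?nb_edgesR_gt0//.
near: s; apply: cvgr_dist_lt; first exact: cvg_id.
by rewrite mulr_gt0 ?nb_edgesR_gt0.
Unshelve. all: by end_near. Qed.

Lemma measurable_edge_point e :
  measurable_fun setT (edge_point phi e : R -> borel (egraph phi)).
Proof.
refine (@measurability _ _ _ (borel (egraph phi)) setT (edge_point phi e)
  (@open (egraph phi)) erefl _).
move=> _ [B oB <-]; rewrite setTI; apply: measurable_realfun.open_measurable.
by apply: open_comp => // t _; exact: continuous_edge_point.
Qed.

(* In particular the metric space is Polish. *)
Lemma compact_egraph : compact [set: egraph phi].
Proof.
have -> : [set: egraph phi] =
    \big[setU/set0]_(e <- enum {: edge G})
      (edge_point phi e @` `[0%R, 1%R]%classic).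
  apply/seteqP; split => // x _; have [e /on_edgeP[t t01 xE]] := on_some_edge x.
  rewrite -bigcup_seq; exists e; first by rewrite /= mem_enum.
  by exists t => //; rewrite /= in_itv /=.
elim/big_ind: _ => [|A B|e _]; [exact: compact0|exact: compactU|].
apply: continuous_compact; last exact: segment_compact.
by apply: continuous_subspaceT => t; exact: continuous_edge_point.
Qed.

(* Normalised length: edges have length 1 / |E|, parametrised by [0, 1]. *)
Definition uniform_measure (A : set (borel (egraph phi))) : \bar R :=
  (((nb_edges G)%:R^-1)%:E *
   \sum_(e : edge G)
     lebesgue_measure (`[0%R, 1%R]%classic `&` edge_point phi e @^-1` A))%E.

Let uniform0 : uniform_measure set0 = 0%E.
Proof.
rewrite /uniform_measure big1 ?mule0// => e _.
by rewrite preimage_set0 setI0 measure0.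
Qed.

Let uniform_ge0 A : (0 <= uniform_measure A)%E.
Proof.
apply: mule_ge0; first by rewrite lee_fin invr_ge0 ler0n.
by apply: sume_ge0 => e _; exact: measure_ge0.
Qed.

Let uniform_sigma_additive : semi_sigma_additive uniform_measure.
Proof.
pose e0 : 'I_(nb_edges G) := Ordinal (nb_edges_gt0 G).
pose ek (k : nat) : edge G := enum_val (insubd e0 k).
pose leb (e : edge G) : {measure set (borel (egraph phi)) -> \bar R} :=
  pushforward (mrestr lebesgue_measure (@measurable_itv R `[0%R, 1%R]))
              (edge_point phi e : R -> borel (egraph phi)).
have -> : uniform_measure =
    mscale ((nb_edges G)%:R^-1)%:nng
      (msum (fun k => leb measurable_edge_point (ek k)) (nb_edges G)).
  apply/funext => A; rewrite /uniform_measure /mscale /msum /=; congr (_ * _)%E.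
  rewrite (reindex (@enum_val _ (mem {: edge G}))) /=.
    apply: eq_bigr => i _; rewrite /leb /pushforward /mrestr /ek setIC.
    by have -> : insubd e0 (i : nat) = i by exact: valKd.
  exists enum_rank => i _; [exact: enum_valK|exact: enum_rankK].
exact: measure_semi_sigma_additive.
Qed.

HB.instance Definition _ := isMeasure.Build _ _ _ uniform_measure
  uniform0 uniform_ge0 uniform_sigma_additive.

Let uniform_setT : uniform_measure setT = 1%E.
Proof.
rewrite /uniform_measure; under eq_bigr do rewrite preimage_setT setIT.
rewrite lebesgue_measure_itv /= lte01 sube0 sumEFin sumr_const -EFinM.
by rewrite mulVf// gt_eqF ?nb_edgesR_gt0.
Qed.

HB.instance Definition _ := Measure_isProbability.Build _ _ _ uniform_measure
  uniform_setT.

End uniform.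
Arguments uniform_measure {R G} phi A.

Definition has_density (R : realType) d (T : measurableType d)
    (mu nu : {measure set T -> \bar R}) (f : T -> R) : Prop :=
  measurable_fun setT f /\
  forall B, measurable B -> mu B = (\int[nu]_(x in B) (f x)%:E)%E.

Definition disint_radius (R : realType) (c alpha : R) (n : nat) : R :=
  4 * c^-1 * Num.sqrt ((2 + alpha) * (ln n%:R / n%:R)).

(* Main.v *)
Require Import Defs.
From HB Require Import structures.
From mathcomp Require Import all_boot all_order all_algebra.
From mathcomp Require Import all_classical all_reals all_analysis.
From mathcomp Require Import lra ring.

Set Implicit Arguments.
Unset Strict Implicit.
Unset Printing Implicit Defensive.

Import Order.TTheory GRing.Theory Num.Theory.
Import numFieldNormedType.Exports.

Local Open Scope classical_set_scope.
Local Open Scope ring_scope.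

(** A disintegration of mu along the balls of radius r about the sample is a
    transport of mu onto the empirical measure of the sample that moves mass by
    at most r.  The idea is to transport along a fine subdivision of the graph,
    so that mass never moves by more than one step of the subdivision.

    Write m = |E|, e = sqrt ((2 + alpha) ln n / n), so that r = 4 e / c.  Cut
    every edge into links of equal length 2h, where h is slightly below e / c,
    and let the cell of a node consist of the half-links (of length h) around it.
    Points of equal or neighbouring cells are within 4h <= r of each other, so
    it is enough to move mass between neighbouring cells.

    If a flow along the links has divergence at each node equal to the excess
    (mass of the cell minus fraction of the sample in the cell), and no link
    carries more than delta, then the flow can be executed in one step as soon
    as each cell owns at least delta for every link at its node
    (flow_transport).  As the density is at least c, each half-link has mass at
    least c h, so this holds when delta <= c h: the mass of a cell grows with
    the degree of its node exactly as the flow out of it does, and high degrees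
    cost nothing.

    Such a flow is obtained by pushing excess through a spanning tree of the
    subdivided graph (connected_balanceable): the flow through a tree link is
    the excess of the branch behind it.  Hence at most as many deviations
    |mu_n(S) - mu(S)| <= delta are needed as there are nodes, for sets S that do
    not depend on the sample.  An exponential Chernoff bound
    (empirical_deviation) with delta = 7/8 e makes each of them fail with
    probability at most 2 n^-2 n^-alpha, and there are at most n^2 / 2 nodes.

    If (m (m - 1)) ^ (m - 1) n^-alpha >= 1, there is nothing to prove.  Otherwise
    2 ^ (m - 1) < n^alpha, so m = O(ln n) and edges are much longer than e / c,
    uniformly over all graphs; they can therefore be cut into links of nearly the
    desired length (choice_of_parameters). *)

(** * Flows and transport plans on finite networks *)

Section flow.
Context (R : realFieldType) (I D : finType) (s t : D -> I).
Hypothesis connected_st : forall (U : {set I}) v w,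
  (forall d, (s d \in U) = (t d \in U)) -> v \in U -> w \in U.

Definition divergence (phi : D -> R) v : R :=
  \sum_(d | s d == v) phi d - \sum_(d | t d == v) phi d.

(** F depends on the network only, not on the excess: F will index finitely many
    events of the sample space.  The flow is required to vanish on the links that
    leave U, so that these are still free when U grows. *)
Definition balanceable (U : {set I}) (F : seq {set I}) : Prop :=
  forall (ex : I -> R) delta, 0 <= delta ->
    (forall v, v \notin U -> ex v = 0) -> \sum_v ex v = 0 ->
    (forall V, V \in F -> `|\sum_(v in V) ex v| <= delta) ->
    exists phi : D -> R,
      [/\ forall d, `|phi d| <= delta,
          forall d, ~~ ((s d \in U) && (t d \in U)) -> phi d = 0 &
          forall v, divergence phi v = ex v].

(** V with w put on the side of u: the preimage of V when w is merged into u. *)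
Definition attach u w (V : {set I}) :=
  if u \in V then (w |: V)%SET else (V :\ w)%SET.

Lemma balanceable1 v0 : balanceable [set v0]%SET [::].
Proof.
move=> ex delta delta_ge0 ex0 sum0 _; exists (fun=> 0); split => //.
  by move=> d; rewrite normr0.
move=> v; rewrite /divergence !big1// subrr.
have [->|vv0] := eqVneq v v0; last by rewrite ex0// inE.
by rewrite -sum0 (bigD1 v0)//= big1 ?addr0// => w ww0; rewrite ex0// inE.
Qed.

(** Adding a leaf w to the spanning tree: the excess of w is sent to its
    neighbour u along d0, and the excess thus merged into u is balanced inside
    U. *)
Lemma balanceableU1 (U : {set I}) F u w d0 : u \in U -> w \notin U ->
  ((s d0 = u) /\ (t d0 = w)) \/ ((s d0 = w) /\ (t d0 = u)) ->
  balanceable U F ->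
  balanceable (w |: U)%SET
    ([set w]%SET :: map (attach u w) F).
Proof.
move=> uU wU d0E IH ex delta delta_ge0 ex0 sum0 exF.
have uw : u != w by apply: contraNneq wU => <-.
pose ex' v := if v == w then 0 else if v == u then ex u + ex w else ex v.
have ex'w : ex' w = 0 by rewrite /ex' eqxx.
have ex'u : ex' u = ex u + ex w by rewrite /ex' (negbTE uw) eqxx.
have ex'E v : v != w -> v != u -> ex' v = ex v.
  by move=> vw vu; rewrite /ex' (negbTE vw) (negbTE vu).
have sumE (V : {set I}) : \sum_(v in V) ex' v =
    \sum_(v in attach u w V) ex v.
  have split2 (f : I -> R) : \sum_v f v =
      f u + (f w + \sum_(v | (v != u) && (v != w)) f v).
    by rewrite (bigD1 u)//= (bigD1 w)//= eq_sym.
  rewrite big_mkcond [RHS]big_mkcond /= 2!split2 ex'w ex'u.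
  rewrite (eq_bigr (fun v => if v \in attach u w V then ex v else 0)); last first.
    move=> v /andP[vu vw]; rewrite ex'E//; congr (if _ then _ else _).
    by rewrite /attach; case: (u \in V); rewrite !inE ?(negbTE vw) ?vw.
  rewrite addrA [RHS]addrA; congr (_ + _); rewrite /attach if_same addr0.
  case: ifPn => uV; rewrite !inE ?eqxx ?uV ?orbT//=.
  by rewrite (negbTE uV) andbF addr0.
have [||V SF|phi [phi_le phi0 phi_div]] := IH ex' delta delta_ge0.
- move=> v vU; rewrite /ex'; case: eqVneq => // vw.
  case: eqVneq => [vu|_]; first by rewrite vu uU in vU.
  by apply: ex0; rewrite !inE negb_or vw.
- have := sumE [set: I]%SET; rewrite /attach inE finset.setUT.
  under eq_bigl do rewrite inE; under [RHS]eq_bigl do rewrite inE.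
  by rewrite sum0.
- rewrite sumE; apply: exF; rewrite inE; apply/orP; right.
  by apply/mapP; exists V.
have phid0 : phi d0 = 0.
  by apply: phi0; case: d0E => -[-> ->]; rewrite (negbTE wU) ?andbF.
have exw : `|ex w| <= delta.
  by have := exF [set w]%SET; rewrite big_set1 inE eqxx; apply.
(* The sign makes a flow into or out of w agree with the direction of d0. *)
pose a : R := if s d0 == w then ex w else - ex w.
exists (fun d => if d == d0 then a else phi d); split.
- move=> d; case: eqVneq => // _; rewrite /a.
  by case: ifP => _; rewrite ?normrN.
- move=> d; case: eqVneq => [->|_].
    by case: d0E => -[-> ->]; rewrite !inE uU eqxx orbT.
  move=> h; apply: phi0; apply: contra h => /andP[sU tU].
  by rewrite !inE sU tU !orbT.
move=> v; have sum_upd (f : D -> I) : \sum_(d | f d == v)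
    (if d == d0 then a else phi d) =
    \sum_(d | f d == v) phi d + (f d0 == v)%:R * a.
  have [fv|fv] := eqVneq (f d0) v; last first.
    rewrite mul0r addr0; apply: eq_bigr => d /eqP fd.
    by case: eqVneq fd => // -> fd; rewrite fd eqxx in fv.
  rewrite (bigD1 d0) ?fv//= eqxx [in RHS](bigD1 d0) ?fv//=.
  rewrite phid0 add0r mul1r addrC.
  by congr (_ + _); apply: eq_bigr => d /andP[_ /negbTE ->].
rewrite /divergence !sum_upd opprD addrACA -/(divergence phi v) phi_div.
have [->|vw] := eqVneq v w; last have [->|vu] := eqVneq v u.
- rewrite ex'w /a; case: d0E => -[-> ->]; rewrite eqxx (negbTE uw) /=; lra.
- rewrite ex'u /a; case: d0E => -[-> ->];
    rewrite ?eqxx ?[w == u]eq_sym ?(negbTE uw) /=; lra.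
rewrite ex'E// /a.
by case: d0E => -[-> ->]; rewrite ![_ == v]eq_sym (negbTE vw) (negbTE vu) /=; lra.
Qed.

(** A spanning tree is grown one vertex at a time; each step contributes a single
    set to F, which becomes the branch behind the corresponding link. *)
Lemma connected_balanceable (v0 : I) :
  exists2 F, (size F <= #|I|)%N & balanceable [set: I]%SET F.
Proof.
suff grow k : (k < #|I|)%N -> exists (U : {set I}) F,
    [/\ #|U| = k.+1, (size F <= k)%N & balanceable U F].
  have I_gt0 : (0 < #|I|)%N by apply/card_gt0P; exists v0.
  have [|U [F [cU sF bU]]] := grow #|I|.-1; first by rewrite prednK.
  have UT : U = [set: I]%SET.
    by apply/eqP; rewrite eqEcard finset.subsetT cU prednK// cardsT leqnn.
  by exists F; [exact: leq_trans sF (leq_pred _)|rewrite -UT].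
elim: k => [_|k IH kI].
  by exists [set v0]%SET, [::]; rewrite cards1; split => //; exact: balanceable1.
have [|U [F [cU sF bU]]] := IH; first exact: ltnW.
have [d sd_td] : exists d, (s d \in U) != (t d \in U).
  apply/existsP; apply: contraT; rewrite negb_exists => /forallP h.
  have [v vU] : exists v, v \in U by apply/card_gt0P; rewrite cU.
  have UT : U = [set: I]%SET.
    apply/setP => w; rewrite inE; apply: connected_st vU => d.
    by apply/eqP; rewrite -[_ == _]negbK h.
  by rewrite UT cardsT in cU; rewrite cU ltnn in kI.
pose G u w := [set w]%SET :: map (attach u w) F.
have step u w : u \in U -> w \notin U ->
    ((s d = u) /\ (t d = w)) \/ ((s d = w) /\ (t d = u)) ->
    exists (U : {set I}) F,
      [/\ #|U| = k.+2, (size F <= k.+1)%N & balanceable U F].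
  move=> uU wU h; exists (w |: U)%SET, (G u w).
  rewrite cardsU1 wU cU /= size_map; split => //.
  exact: balanceableU1 uU wU h bU.
move: sd_td; have [sU|sU] := boolP (s d \in U);
  have [tU|tU] := boolP (t d \in U) => // _.
- by apply: step sU tU _; left.
- by apply: step tU sU _; right.
Qed.

End flow.

Section transport.
Context (R : realFieldType) (I D : finType) (s t : D -> I).

Definition one_step a b : Prop :=
  a = b \/ exists d, (s d = a /\ t d = b) \/ (s d = b /\ t d = a).

Definition transport_plan (p q : I -> R) (rho : I -> I -> R) : Prop :=
  [/\ forall a b, 0 <= rho a b, forall a, \sum_b rho a b = p a &
      forall b, \sum_a rho a b = q b].

(** The outflow of v is at most delta per link at v, hence at most p v; it can
    therefore be taken entirely from the mass initially at v, and no mass travels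
    along two links. *)
Lemma flow_transport (p q : I -> R) (phi : D -> R) delta :
  (forall d, `|phi d| <= delta) ->
  (forall v, divergence s t phi v = p v - q v) ->
  (forall v, delta *+ #|[pred d | s d == v]| + delta *+ #|[pred d | t d == v]|
     <= p v) ->
  exists2 rho, transport_plan p q rho &
    forall a b, rho a b != 0 -> one_step a b.
Proof.
move=> phi_le phi_div p_ge.
pose pp d := Num.max (phi d) 0; pose pn d := Num.max (- phi d) 0.
have ppn d : phi d = pp d - pn d by rewrite /pp /pn /Num.max; do 2 case: ifP; lra.
have pp_ge0 d : 0 <= pp d by rewrite /pp le_max lexx orbT.
have pn_ge0 d : 0 <= pn d by rewrite /pn le_max lexx orbT.
have pp_le d : pp d <= delta.
  by rewrite ge_max (le_trans (ler_norm _) (phi_le d)) (le_trans _ (phi_le d)).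
have pn_le d : pn d <= delta.
  rewrite ge_max (le_trans _ (phi_le d)) ?(le_trans _ (phi_le d))//.
  by rewrite -normrN ler_norm.
pose out a := \sum_(d | s d == a) pp d + \sum_(d | t d == a) pn d.
have out_le a : out a <= p a.
  apply: le_trans (p_ge a); rewrite -!sumr_const.
  by apply: lerD; apply: ler_sum => d _.
pose rho a b := (a == b)%:R * (p a - out a) +
  (\sum_(d | s d == a) (t d == b)%:R * pp d +
   \sum_(d | t d == a) (s d == b)%:R * pn d).
have diag (F : I -> R) (x : I) : \sum_y (x == y)%:R * F y = F x.
  rewrite (bigD1 x)//= eqxx mul1r big1 ?addr0// => y.
  by rewrite eq_sym => /negbTE ->; rewrite mul0r.
have part (f g : D -> I) (F : D -> R) (a : I) :
    \sum_b \sum_(d | f d == a) (g d == b)%:R * F d = \sum_(d | f d == a) F d.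
  rewrite exchange_big /=; apply: eq_bigr => d _.
  exact: (diag (fun=> F d)).
have part' (f g : D -> I) (F : D -> R) (b : I) :
    \sum_a \sum_(d | f d == a) (g d == b)%:R * F d = \sum_(d | g d == b) F d.
  under eq_bigr do rewrite big_mkcond /=.
  rewrite exchange_big [RHS]big_mkcond /=; apply: eq_bigr => d _.
  rewrite (bigD1 (f d))//= eqxx big1 ?addr0 => [|a]; last first.
    by rewrite eq_sym => /negbTE ->.
  by case: eqP; rewrite ?mul1r ?mul0r.
exists rho; first split.
- move=> a b; rewrite /rho !addr_ge0//.
  + by rewrite mulr_ge0// subr_ge0.
  + by apply: sumr_ge0 => d _; rewrite mulr_ge0.
  + by apply: sumr_ge0 => d _; rewrite mulr_ge0.
- move=> a; rewrite /rho 2!big_split /= !part.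
  by rewrite (diag (fun=> p a - out a)) -/(out a) subrK.
- move=> b; rewrite /rho 2!big_split /= !part'.
  under eq_bigr do rewrite eq_sym.
  rewrite (diag (fun a => p a - out a)).
  have := phi_div b; rewrite /divergence /out.
  under eq_bigr do rewrite ppn; rewrite sumrB.
  under [X in _ - X]eq_bigr do rewrite ppn; rewrite sumrB.
  lra.
move=> a b; have [-> _|ab] := eqVneq a b; first by left.
rewrite /rho (negbTE ab) mul0r add0r => rab; right.
have [/existsP[d]|] := boolP [exists d,
    ((s d == a) && (t d == b)) || ((s d == b) && (t d == a))].
  by move=> /orP[]/andP[/eqP ? /eqP ?]; exists d; [left|right].
rewrite negb_exists => /forallP h; move: rab; rewrite !big1 ?addr0 ?eqxx//.
  move=> d /eqP da; have := h d; rewrite da eqxx andbT.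
  by case: (s d == b); rewrite ?mul0r ?orbT.
move=> d /eqP da; have := h d; rewrite da eqxx.
by case: (t d == b); rewrite ?mul0r.
Qed.

End transport.

(** * Deviations of the empirical measure *)

Section bernoulli.
Context (R : realType).
Implicit Types p t x : R.

(** A coefficient a in place of 3/4 leads to the exponent n delta^2 / a in
    bernoulli_two_sided; what matters is that a < 1, which leaves room for delta
    to be smaller than the root in the radius.  The estimate comes from
    exp (- x / 3) >= 1 - x / 3, cubed. *)
Lemma expR_le_quadratic x : `|x| <= 1/10 -> expR x <= 1 + x + 3/4 * x ^+ 2.
Proof.
rewrite ler_norml => /andP[x_ge x_le].
have y_gt0 : 0 < 1 - x / 3 by lra.
have expRN3 : (1 - x / 3) ^+ 3 <= (expR x)^-1.
  rewrite -expRN; have -> : - x = 3%:R * (- (x / 3)) by lra.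
  rewrite expRM_natl lerXn2r// ?nnegrE ?expR_ge0 ?(ltW y_gt0)//.
  exact: expR_ge1Dx.
rewrite -[expR x]invrK invf_ple ?posrE ?invr_gt0 ?expR_gt0//; last nra.
apply: le_trans expRN3.
rewrite -div1r ler_pdivrMr; last nra.
have x2 : 0 <= x ^+ 2 by rewrite sqr_ge0.
(* (1 + x + 3/4 x^2) (1 - x / 3)^3 - 1, factored. *)
have : 0 <= x ^+ 2 * (1/12 - 49/108 * x + 23/108 * x ^+ 2 - 1/36 * x ^+ 3).
  rewrite mulr_ge0//; nra.
nra.
Qed.

(** The centred Bernoulli variable has variance p (1 - p) <= 1/4, whence
    3/16 = 3/4 * 1/4. *)
Lemma bernoulli_mgf_le p t : 0 <= p <= 1 -> `|t| <= 1/10 ->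
  p * expR (t * (1 - p)) + (1 - p) * expR (- (t * p)) <= expR (3/16 * t ^+ 2).
Proof.
move=> /andP[p0 p1]; rewrite ler_norml => /andP[t_ge t_le].
have h1 : expR (t * (1 - p)) <= 1 + t * (1 - p) + 3/4 * (t * (1 - p)) ^+ 2.
  by apply: expR_le_quadratic; rewrite ler_norml; apply/andP; split; nra.
have h2 : expR (- (t * p)) <= 1 + - (t * p) + 3/4 * (- (t * p)) ^+ 2.
  by apply: expR_le_quadratic; rewrite ler_norml; apply/andP; split; nra.
apply: le_trans (expR_ge1Dx _).
have {}h1 := ler_wpM2l p0 h1.
have q0 : 0 <= 1 - p by lra.
have {}h2 := ler_wpM2l q0 h2.
apply: le_trans (lerD h1 h2) _.
have : 0 <= t ^+ 2 * (1 - 2 * p) ^+ 2 by rewrite mulr_ge0// sqr_ge0.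
nra.
Qed.

(** The probability that J is the set of successes in n independent trials of
    success probability p. *)
Definition bernoulli_weight n p (J : {set 'I_n}) : R :=
  \prod_(i < n) (if i \in J then p else 1 - p).

Lemma bernoulli_weight_ge0 n p (J : {set 'I_n}) : 0 <= p <= 1 ->
  0 <= bernoulli_weight p J.
Proof.
by move=> p01; apply: prodr_ge0 => i _; case: ifP => _; lra.
Qed.

Lemma bernoulli_mgf n p t :
  \sum_(J : {set 'I_n})
    bernoulli_weight p J * expR (t * (#|J|%:R - n%:R * p)) =
  (p * expR (t * (1 - p)) + (1 - p) * expR (- (t * p))) ^+ n.
Proof.
transitivity (\prod_(i < n)
    (p * expR (t * (1 - p)) + (1 - p) * expR (- (t * p)))); last first.
  by rewrite prodr_const card_ord.
rewrite bigA_distr /=; apply: eq_bigr => J _.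
have -> : #|J|%:R - n%:R * p = \sum_(i < n) (if i \in J then 1 - p else - p).
  have -> : #|J|%:R = \sum_(i < n) (i \in J)%:R :> R.
    by rewrite -natr_sum -sum1_card big_mkcond.
  have -> : n%:R * p = \sum_(i < n) p by rewrite sumr_const card_ord mulr_natl.
  by rewrite -sumrB; apply: eq_bigr => i _; case: ifP; rewrite // sub0r.
rewrite mulr_sumr expR_sum /bernoulli_weight -big_split /=.
by apply: eq_bigr => i _; case: ifP; rewrite // mulrN.
Qed.

(** Exponential Markov inequality; Q is a one-sided deviation event, and the sign
    of t selects the side. *)
Lemma chernoff_bound n p t a (Q : pred {set 'I_n}) :
  0 <= p <= 1 -> `|t| <= 1/10 ->
  (forall J, Q J -> a <= t * (#|J|%:R - n%:R * p)) ->
  \sum_(J | Q J) bernoulli_weight p J <= expR (3/16 * t ^+ 2 * n%:R - a).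
Proof.
move=> p01 t_le aQ.
apply: (@le_trans _ _ (\sum_(J : {set 'I_n})
    bernoulli_weight p J * expR (t * (#|J|%:R - n%:R * p)) * expR (- a))).
  rewrite [leRHS](bigID Q) /= -[leLHS]addr0; apply: lerD.
    apply: ler_sum => J QJ; rewrite -mulrA ler_peMr ?bernoulli_weight_ge0//.
    by rewrite -expRD; apply: le_trans (expR_ge1Dx _); have := aQ J QJ; lra.
  by apply: sumr_ge0 => J _; rewrite !mulr_ge0 ?expR_ge0 ?bernoulli_weight_ge0.
rewrite -mulr_suml bernoulli_mgf expRD ler_wpM2r ?expR_ge0//.
rewrite expRM_natr lerXn2r ?nnegrE ?expR_ge0 ?bernoulli_mgf_le//.
by rewrite addr_ge0// mulr_ge0 ?expR_ge0//; lra.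
Qed.

Lemma bernoulli_two_sided n p delta : 0 <= p <= 1 -> 0 <= delta <= 3/80 ->
  \sum_(J : {set 'I_n} | n%:R * delta < `|#|J|%:R - n%:R * p|)
    bernoulli_weight p J <= 2 * expR (- (4/3 * (n%:R * delta ^+ 2))).
Proof.
move=> p01 delta01.
rewrite (bigID (fun J : {set 'I_n} => 0 <= #|J|%:R - n%:R * p)) /=.
(* 8/3 delta minimises 3/16 t^2 - t delta. *)
have E : - (4/3 * (n%:R * delta ^+ 2)) =
    3/16 * (8/3 * delta) ^+ 2 * n%:R - 8/3 * delta * (n%:R * delta) by field.
have -> : 2 * expR (- (4/3 * (n%:R * delta ^+ 2))) =
    expR (- (4/3 * (n%:R * delta ^+ 2))) + expR (- (4/3 * (n%:R * delta ^+ 2))).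
  by lra.
apply: lerD.
  rewrite E; apply: chernoff_bound => // [|J /andP[h h0]].
    by rewrite ger0_norm; lra.
  by rewrite ler_wpM2l//; [lra|rewrite ger0_norm// in h; exact: ltW].
rewrite E -sqrrN; apply: chernoff_bound => // [|J /andP[h h0]].
  by rewrite normrN ger0_norm; lra.
rewrite mulNr -mulrN ler_wpM2l//; first lra.
by rewrite ler0_norm ?(ltW h)// in h *; [exact: ltW|rewrite ltW// ltNge].
Qed.

End bernoulli.

(** The union bound. *)
Lemma le_measure_bigsetU d (T : measurableType d) (R : realType)
    (mu : {measure set T -> \bar R}) (I : Type) (r : seq I) (Q : pred I)
    (F : I -> set T) : (forall i, measurable (F i)) ->
  (mu (\big[setU/set0]_(i <- r | Q i) F i) <= \sum_(i <- r | Q i) mu (F i))%E.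
Proof.
move=> mF; elim: r => [|i r IH]; first by rewrite !big_nil measure0.
rewrite !big_cons; case: ifP => // _.
apply: le_trans (leeD2l _ IH); apply: measureU2 => //.
exact: bigsetU_measurable.
Qed.

Section empirical.
Context (R : realType) d (Psi : measurableType d) (P : probability Psi R)
  d' (T : measurableType d') (mu : probability T R) (n : nat)
  (X : 'I_n -> {RV P >-> T}).
Hypothesis X_iid : iid mu X.

Definition hits (M : set T) (w : Psi) : {set 'I_n} :=
  [set i | `[< M (X i w) >]]%SET.

Lemma hits_measurable M (J : {set 'I_n}) : measurable M ->
  measurable [set w | hits M w = J].
Proof.
move=> mM; rewrite (_ : [set w | _] =
    \bigcap_(i in [set: 'I_n]) (X i @^-1` (if i \in J then M else ~` M))).
  apply: fin_bigcap_measurable => // i _; apply: measurable_funPTI.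
  by case: ifP => // _; exact: measurableC.
apply/seteqP; split => [w <- i _|w h] /=.
  by rewrite inE; case: asboolP.
apply/setP => i; rewrite inE; have := h i I.
by rewrite /=; case: ifP => _ hi; apply/asboolP.
Qed.

(** The product rule applied to M for the indices in J and to its complement for
    the others; this is the only use of independence. *)
Lemma hits_probability M (J : {set 'I_n}) : measurable M ->
  P [set w | hits M w = J] = (bernoulli_weight (fine (mu M)) J)%:E.
Proof.
move=> mM; pose B i := if i \in J then M else ~` M.
have mB i : measurable (B i).
  by rewrite /B; case: ifP => // _; exact: measurableC.
have -> : [set w | hits M w = J] =
    \bigcap_(i in [set` [set: 'I_n]%SET]) (X i @^-1` B i).
  apply/seteqP; split => [w /= hw i _|w h] /=.
    by rewrite /B -hw inE; case: asboolP.
  apply/setP => i; rewrite inE; have := h i.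
  by rewrite /= inE /B => /(_ isT); case: ifP => _ hi; apply/asboolP.
rewrite X_iid.1; last by move=> i _; exact: mB.
under eq_bigl do rewrite inE.
rewrite /bernoulli_weight -prodEFin; apply: eq_bigr => i _.
transitivity (mu (B i)); first by rewrite -(X_iid.2 i).
rewrite /B; case: ifP => _; first by rewrite fineK ?fin_num_measure.
by rewrite probability_setC// EFinB fineK ?fin_num_measure.
Qed.

Lemma empirical_deviation M delta : measurable M -> 0 <= delta <= 3/80 ->
  exists B, [/\ measurable B,
    (P B <= (2 * expR (- (4/3 * (n%:R * delta ^+ 2))))%:E)%E &
    forall w, ~ B w -> `|#|hits M w|%:R - n%:R * fine (mu M)| <= n%:R * delta].
Proof.
move=> mM delta_le.
pose bad (J : {set 'I_n}) := n%:R * delta < `|#|J|%:R - n%:R * fine (mu M)|.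
exists (\big[setU/set0]_(J | bad J) [set w | hits M w = J]); split.
- by apply: bigsetU_measurable => J _; exact: hits_measurable.
- apply: le_trans (le_measure_bigsetU _ _ _ _) _.
    by move=> J; exact: hits_measurable.
  rewrite (eq_bigr (fun J => (bernoulli_weight (fine (mu M)) J)%:E)) => [|J _];
    last exact: hits_probability.
  rewrite sumEFin lee_fin; apply: bernoulli_two_sided => //.
  apply/andP; split; first by rewrite fine_ge0.
  by rewrite -lee_fin fineK ?fin_num_measure// probability_le1.
move=> w Bw; rewrite leNgt; apply/negP => bad_w; apply: Bw.
rewrite -bigcup_seq_cond; exists (hits M w) => //=.
by rewrite mem_index_enum.
Qed.

End empirical.

(** * Disintegration from a transport plan *)

Lemma mnormalize_total1 d (T : measurableType d) (R : realType)
    (m : {measure set T -> \bar R}) (P : probability T R) B :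
  m setT = 1%E -> mnormalize m P B = m B.
Proof. by rewrite /mnormalize => ->; rewrite onee_eq0 /= invr1 mule1. Qed.

Section mixture.
Context d (T : measurableType d) (R : realType) (mu : probability T R)
  (K : finType) (g : T -> K).
Hypothesis mg : forall k, measurable (g @^-1` [set k]).

Lemma measure_fibers B : measurable B ->
  mu B = (\sum_k mu (B `&` g @^-1` [set k]))%E.
Proof.
move=> mB; rewrite fsbig_seq ?index_enum_uniq//.
rewrite (_ : [set` index_enum K] = setT); last first.
  by apply/seteqP; split => // k _ /=; rewrite mem_index_enum.
rewrite -measure_fin_bigcup//; first by
  congr (mu _); apply/seteqP; split => [x Bx|x [k _ []]]//; exists (g x).
- exact: finite_finset.
- by move=> i j _ _ [x [[_ /= <-] [_ /= <-]]].
- by move=> k _; exact: measurableI.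
Qed.

Definition fiber_mass k : R := fine (mu (g @^-1` [set k])).

Lemma fiber_massE k : (fiber_mass k)%:E = mu (g @^-1` [set k]).
Proof. by rewrite fineK ?fin_num_measure. Qed.

Lemma sum_fiber_mass : \sum_k fiber_mass k = 1.
Proof.
apply: EFin_inj; rewrite -sumEFin -[RHS](probability_setT mu) measure_fibers//.
by apply: eq_bigr => k _; rewrite setTI fiber_massE.
Qed.

Lemma fiber_reweighting (c : K -> R) : (forall k, 0 <= c k) ->
  \sum_k c k * fiber_mass k = 1 ->
  exists nu : probability T R, forall B,
    nu B = (\sum_k (c k)%:E * mu (B `&` g @^-1` [set k]))%E.
Proof.
move=> c_ge0 c1.
have [k0 _] : exists k0 : K, True.
  apply: contrapT => K0; have := c1; rewrite big1 => [/eqP|k _].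
    by rewrite eq_sym oner_eq0.
  by case: K0; exists k.
pose el (j : nat) := nth k0 (index_enum K) j.
pose m : {measure set T -> \bar R} :=
  msum (fun j => mscale (NngNum (c_ge0 (el j))) (mrestr mu (mg (el j))))
    (size (index_enum K)).
have mE B : m B = (\sum_k (c k)%:E * mu (B `&` g @^-1` [set k]))%E.
  by rewrite (big_nth k0) big_mkord.
have m1 : m setT = 1%E.
  rewrite mE -c1 -sumEFin; apply: eq_bigr => k _.
  by rewrite setTI EFinM fiber_massE.
exists (mnormalize m mu) => B; rewrite -mE; exact: mnormalize_total1.
Qed.

(** A plan between the cell masses of mu and of the empirical measure becomes a
    disintegration: x i receives from cell k the normalised share of mu on k that
    the plan sends to the cell of x i, split evenly among the sample points
    there. *)
Lemma transport_disintegration n (x : 'I_n -> T) (rho : K -> K -> R) :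
  (0 < n)%N -> (forall k, 0 < fiber_mass k) ->
  transport_plan fiber_mass
    (fun k => #|[set i | g (x i) == k]%SET|%:R / n%:R) rho ->
  exists nu : 'I_n -> probability T R,
    (forall i M,
      (forall k, rho k (g (x i)) != 0 -> g @^-1` [set k] `<=` M) ->
      nu i M = 1%E) /\
    (forall B, measurable B ->
      mu B = ((n%:R^-1)%:E * \sum_(i < n) nu i B)%E).
Proof.
move=> n_gt0 p_gt0 [rho_ge0 rho_p rho_q].
have nR_gt0 : 0 < n%:R :> R by rewrite ltr0n.
pose q k : R := #|[set i | g (x i) == k]%SET|%:R / n%:R.
pose c i k := rho k (g (x i)) / (q (g (x i)) * fiber_mass k).
have q_ge0 k : 0 <= q k by rewrite divr_ge0.
have q_gt0 i : 0 < q (g (x i)).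
  rewrite divr_gt0// ltr0n; apply/card_gt0P; exists i.
  by rewrite inE.
have c_ge0 i k : 0 <= c i k by rewrite divr_ge0// mulr_ge0// ltW.
have cM i k : c i k * fiber_mass k = rho k (g (x i)) / q (g (x i)).
  by rewrite /c; field; rewrite !gt_eqF.
have c1 i : \sum_k c i k * fiber_mass k = 1.
  under eq_bigr do rewrite cM.
  by rewrite -mulr_suml rho_q -/(q _) divff ?gt_eqF.
have /choice[nu nuE] i := fiber_reweighting (c_ge0 i) (c1 i).
exists nu; split.
  move=> i M sub; rewrite nuE -(c1 i) -sumEFin; apply: eq_bigr => k _.
  have [r0|r0] := eqVneq (rho k (g (x i))) 0.
    by rewrite /c r0 !mul0r mul0e.
  by rewrite (setIidr (sub _ r0)) [RHS]EFinM fiber_massE.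
move=> B mB; pose u k := fine (mu (B `&` g @^-1` [set k])).
have uE k : (u k)%:E = mu (B `&` g @^-1` [set k]).
  by rewrite fineK ?fin_num_measure//; exact: measurableI.
have -> : mu B = (\sum_k u k)%:E.
  by rewrite measure_fibers// -sumEFin; apply: eq_bigr => k _.
have nuB i : nu i B = (\sum_k c i k * u k)%:E.
  by rewrite nuE -sumEFin; apply: eq_bigr => k _; rewrite [RHS]EFinM uE.
rewrite (eq_bigr (fun i => (\sum_k c i k * u k)%:E)) => [|i _]; last exact: nuB.
rewrite sumEFin -EFinM; congr EFin.
rewrite exchange_big /= mulr_sumr; apply: eq_bigr => k _.
rewrite -mulr_suml mulrA -[LHS]mul1r; congr (_ * _).
(* Sample points of the same fibre have the same weights. *)
have -> : \sum_(i < n) c i k = \sum_b n%:R * (rho k b / fiber_mass k).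
  rewrite (partition_big (g \o x) predT)//=; apply: eq_bigr => b _.
  rewrite (eq_bigr (fun=> rho k b / (q b * fiber_mass k))); last first.
    by move=> i /eqP <-.
  rewrite sumr_const.
  have [q0|q0] := eqVneq (q b) 0.
    have : \sum_a rho a b == 0 by rewrite rho_q -/(q b) q0.
    rewrite psumr_eq0//; move=> /allP/(_ k (mem_index_enum k)) /eqP ->.
    by rewrite !mul0r mul0rn mulr0.
  have -> : #|[pred i | g (x i) == b]| = #|[set i | g (x i) == b]%SET|.
    by apply: eq_card => i; rewrite !inE.
  rewrite -[LHS]mulr_natl.
  have -> : #|[set i | g (x i) == b]%SET|%:R = n%:R * q b.
    by rewrite /q mulrC divfK ?gt_eqF.
  by field; rewrite q0 gt_eqF.
rewrite -mulr_sumr mulrA mulVf ?gt_eqF// mul1r -mulr_suml rho_p divff//.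
by rewrite gt_eqF.
Qed.

End mixture.

Section sampled_network.
Context (R : realType) d' (T : measurableType d') (mu : probability T R)
  (I D : finType) (s t : D -> I) (g : T -> D * bool).
Hypothesis connected_st : forall (U : {set I}) v w,
  (forall d, (s d \in U) = (t d \in U)) -> v \in U -> w \in U.
Hypothesis mg : forall k, measurable (g @^-1` [set k]).

(** (d, b) stands for the half of the link d next to its source or its target, and
    g tells in which half-link a point lies. *)
Definition end_node (h : D * bool) : I := if h.2 then t h.1 else s h.1.
Hypothesis end_node_surj : forall v, exists h, end_node h = v.

Definition cell_of x : I := end_node (g x).

Lemma measurable_cell_of v : measurable (cell_of @^-1` [set v]).
Proof.
have -> : cell_of @^-1` [set v] =
    \big[setU/set0]_(h | end_node h == v) (g @^-1` [set h]).
  rewrite -bigcup_seq_cond; apply/seteqP; split => x /=.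
    by move=> <-; exists (g x) => //=; rewrite mem_index_enum eqxx.
  by move=> [h /= /andP[_ /eqP <-] <-].
by apply: bigsetU_measurable => h _.
Qed.

(** A cell contains one half-link for each end of a link at v. *)
Lemma cell_mass_ge (delta : R) v : (forall h, delta <= fiber_mass mu g h) ->
  delta *+ #|[pred d | s d == v]| + delta *+ #|[pred d | t d == v]|
    <= fiber_mass mu cell_of v.
Proof.
move=> g_ge; have -> : fiber_mass mu cell_of v =
    \sum_(h | end_node h == v) fiber_mass mu g h.
  apply: EFin_inj; rewrite fiber_massE; last exact: measurable_cell_of.
  rewrite (measure_fibers mu mg (measurable_cell_of v)) -sumEFin.
  rewrite [RHS]big_mkcond; apply: eq_bigr => h _.
  rewrite fiber_massE//; case: eqP => hv.
    by congr (mu _); apply/seteqP; split => [x []//|x /= xh]; rewrite /cell_of xh.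
  rewrite (_ : _ `&` _ = set0) ?measure0//.
  by apply/seteqP; split => // x [/= + xh]; rewrite /cell_of xh.
have -> : \sum_(h | end_node h == v) fiber_mass mu g h =
    \sum_(d | s d == v) fiber_mass mu g (d, false) +
    \sum_(d | t d == v) fiber_mass mu g (d, true).
  transitivity (\sum_d \sum_b
      if end_node (d, b) == v then fiber_mass mu g (d, b) else 0).
    by rewrite pair_bigA big_mkcond; apply: eq_bigr => -[].
  rewrite [X in _ = X + _]big_mkcond [X in _ = _ + X]big_mkcond -big_split /=.
  by apply: eq_bigr => d _; rewrite big_bool addrC.
by rewrite -!sumr_const; apply: lerD; apply: ler_sum.
Qed.

(** The event A asks that the empirical measure and mu agree up to delta on the
    regions given by connected_balanceable.  On A the excess of every cell is the
    divergence of a flow of strength delta, which flow_transport and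
    transport_disintegration turn into the measures nu i. *)
Lemma sampled_network_disintegration d (Psi : measurableType d)
    (P : probability Psi R) n (X : 'I_n -> {RV P >-> T}) (delta : R) :
  iid mu X -> (0 < n)%N -> 0 < delta <= 3/80 ->
  (forall h, delta <= fiber_mass mu g h) ->
  exists A, [/\ measurable A,
    ((1 - #|I|%:R * (2 * expR (- (4/3 * (n%:R * delta ^+ 2)))))%:E <= P A)%E &
    forall w, A w -> exists nu : 'I_n -> probability T R,
      (forall i M,
        (forall y, one_step s t (cell_of y) (cell_of (X i w)) -> M y) ->
        nu i M = 1%E) /\
      (forall B, measurable B ->
        mu B = ((n%:R^-1)%:E * \sum_(i < n) nu i B)%E)].
Proof.
move=> X_iid n_gt0 /andP[delta_gt0 delta_le] g_ge.
have nR_gt0 : 0 < n%:R :> R by rewrite ltr0n.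
set eta := 2 * _.
pose p v := fiber_mass mu cell_of v.
have mC := measurable_cell_of.
have p_gt0 v : 0 < p v.
  apply: lt_le_trans (cell_mass_ge v g_ge).
  have [[d0 b] /= <-] := end_node_surj v; rewrite /end_node /=.
  case: b.
    apply: ltr_wpDl; first by rewrite mulrn_wge0// ltW.
    by rewrite pmulrn_lgt0//; apply/card_gt0P; exists d0; rewrite inE.
  apply: ltr_wpDr; first by rewrite mulrn_wge0// ltW.
  by rewrite pmulrn_lgt0//; apply/card_gt0P; exists d0; rewrite inE.
have v0 : I.
  have : exists v : I, True.
    apply: contrapT => I0; have := sum_fiber_mass mu mC.
    rewrite big1 => [/eqP|v _]; first by rewrite eq_sym oner_eq0.
    by case: I0; exists v.
  by move=> /cid[v _].
have [F sF bF] := connected_balanceable R connected_st v0.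
pose region (V : {set I}) : set T := [set x | cell_of x \in V].
have regionE (V : {set I}) : region V =
    \big[setU/set0]_(v in V) (cell_of @^-1` [set v]).
  rewrite -bigcup_seq_cond; apply/seteqP; split => x /=.
    by move=> xV; exists (cell_of x) => //=; rewrite mem_index_enum.
  by move=> [v /= /andP[_ vV] xv]; rewrite /region /= xv.
have mregion V : measurable (region V).
  by rewrite regionE; apply: bigsetU_measurable => v _.
have region_mass (V : {set I}) : fine (mu (region V)) = \sum_(v in V) p v.
  apply: EFin_inj; rewrite fineK ?fin_num_measure//.
  rewrite (measure_fibers mu mC)// -sumEFin [RHS]big_mkcond.
  apply: eq_bigr => v _; rewrite fiber_massE//; case: ifPn => vV.
    by congr (mu _); apply/seteqP; split => [x []//|x /= xv]; split => //=;
      rewrite /region /= xv.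
  rewrite (_ : _ `&` _ = set0) ?measure0//.
  by apply/seteqP; split => // x [/= + xv]; rewrite /region /= xv (negbTE vV).
have delta01 : 0 <= delta <= 3/80 by rewrite ltW.
have /choice[bad badP] V := empirical_deviation X_iid (mregion V) delta01.
exists (~` \big[setU/set0]_(V <- F) bad V).
have mbad : measurable (\big[setU/set0]_(V <- F) bad V).
  by apply: bigsetU_measurable => V _; case: (badP V).
split.
- exact: measurableC.
- rewrite probability_setC// EFinB; apply: leeB => //.
  apply: le_trans (le_measure_bigsetU _ _ _ _) _.
    by move=> V; case: (badP V).
  apply: (@le_trans _ _ (\sum_(V <- F) eta%:E)%E).
    by apply: lee_sum => V _; case: (badP V).
  rewrite sumEFin lee_fin big_const_seq count_predT iter_addr_0 -[leLHS]mulr_natl.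
  by rewrite ler_wpM2r ?ler_nat// mulr_ge0// expR_ge0.
move=> w Aw.
pose q v : R := #|[set i | cell_of (X i w) == v]%SET|%:R / n%:R.
have sum_q (V : {set I}) : \sum_(v in V) q v = #|hits X (region V) w|%:R / n%:R.
  rewrite -mulr_suml -natr_sum; congr (_%:R / _).
  rewrite -sum1_card (partition_big (fun i => cell_of (X i w)) (mem V)) /=.
    apply: eq_bigr => v vV; rewrite -sum1_card; apply: eq_bigl => i.
    rewrite [LHS]inE [X in _ = X && _]inE.
    case: eqVneq => [cv|_]; rewrite ?andbF// andbT.
    by apply/esym/asboolP; rewrite /region /= cv.
  by move=> i; rewrite inE => /asboolP.
have := bF (fun v => p v - q v) delta (ltW delta_gt0).
case.
- by move=> v; rewrite inE.
- rewrite sumrB (sum_fiber_mass mu mC).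
  have := sum_q [set: I]%SET; under eq_bigl do rewrite inE; move=> ->.
  rewrite (_ : hits _ _ _ = [set: 'I_n]%SET).
    by rewrite cardsT card_ord divff ?subrr ?gt_eqF.
  by apply/setP => i; rewrite !inE; apply/asboolP; rewrite /region /= inE.
- move=> V VF; rewrite sumrB sum_q -region_mass.
  have badw : ~ bad V w.
    by move=> bw; apply: Aw; rewrite -bigcup_seq; exists V.
  have [_ _ /(_ w badw)] := badP V.
  have -> : #|hits X (region V) w|%:R - n%:R * fine (mu (region V)) =
      n%:R * (#|hits X (region V) w|%:R / n%:R - fine (mu (region V))).
    by field; rewrite gt_eqF.
  by rewrite normrM gtr0_norm// ler_pM2l// distrC.
move=> phi [phi_le _ phi_div].
have [|rho rho_plan rho_step] := flow_transport phi_le phi_div.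
  by move=> v; exact: cell_mass_ge.
have [nu [nu1 nu2]] := transport_disintegration mC n_gt0 p_gt0 rho_plan.
exists nu; split => // i M h; apply: nu1 => // v /rho_step vs x /= xv.
by apply: h; rewrite xv.
Qed.

End sampled_network.

(** * Subdividing an embedded graph *)

(** The pieces K h may overlap (half-links share end points); each point is given
    to the first piece that contains it. *)
Lemma measurable_cover_selection d (T : measurableType d) (H : finType)
    (K : H -> set T) :
  (forall h, measurable (K h)) -> (forall x, exists h, K h x) ->
  exists g : T -> H,
    (forall x, K (g x) x) /\ forall h, measurable (g @^-1` [set h]).
Proof.
move=> mK cov; have /choice[h0 Kh0] := cov.
pose g x := [arg min_(h < h0 x | `[< K h x >]) enum_rank h]%N.
have gP x : K (g x) x /\ forall h, K h x -> (enum_rank (g x) <= enum_rank h)%N.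
  rewrite /g; case: arg_minnP => [|h /asboolP Kh hmin]; first exact/asboolP.
  by split => // h' Kh'; apply: hmin; exact/asboolP.
exists g; split => [x|h]; first by case: (gP x).
have -> : g @^-1` [set h] = K h `\`
    \big[setU/set0]_(h' | (enum_rank h' < enum_rank h)%N) K h'.
  rewrite -bigcup_seq_cond; apply/seteqP; split => x /=.
    move=> <-; have [Kg gmin] := gP x; split => // -[h' /= /andP[_ h'g] Kh'].
    by have := gmin _ Kh'; rewrite leqNgt h'g.
  move=> [Kh nK]; have [Kg gmin] := gP x.
  apply/enum_rank_inj/val_inj/eqP; rewrite eqn_leq (gmin _ Kh)/= leqNgt.
  by apply/negP => gh; apply: nK; exists (g x) => //=; rewrite mem_index_enum.
by apply: measurableD => //; exact: bigsetU_measurable.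
Qed.

Lemma density_ge d (T : measurableType d) (R : realType)
    (mu nu : {measure set T -> \bar R}) (f : T -> R) (c : R) B :
  has_density mu nu f -> 0 <= c -> (forall x, c <= f x) -> measurable B ->
  (c%:E * nu B <= mu B)%E.
Proof.
move=> [mf muE] c_ge0 cf mB; rewrite muE// -integral_cst//.
apply: ge0_le_integral => //.
- by apply/measurable_realfun.measurable_EFinP; apply: measurable_funS mf.
- by move=> x _; rewrite lee_fin.
Qed.

Section subdivision.
Context (R : realType) (G : cgraph) (phi : embedding R G) (k : nat).
Implicit Types (e : edge G).

(** The vertices of G and the inner division points of its edges. *)
Definition node : finType := (G + edge G * 'I_k)%type.
Definition link : finType := (edge G * 'I_k.+1)%type.

(** The division points of e, from src e (j = 0) to tgt e (j = k + 1); the shift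
    by one lets the ends be the vertices of G, shared between edges. *)
Definition node_at e (j : nat) : node :=
  if j is j'.+1 then
    if (insub j' : option 'I_k) is Some i then inr (e, i) else inl (tgt e)
  else inl (src e).

Definition link_src (d : link) : node := node_at d.1 d.2.
Definition link_tgt (d : link) : node := node_at d.1 d.2.+1.

Lemma node_at_end e : node_at e k.+1 = inl (tgt e).
Proof. by rewrite /node_at insubF// ltnn. Qed.

Lemma node_at_inner e (i : 'I_k) : node_at e i.+1 = inr (e, i).
Proof. by rewrite /node_at valK. Qed.

Lemma subdivision_connected (U : {set node}) v w :
  (forall d, (link_src d \in U) = (link_tgt d \in U)) -> v \in U -> w \in U.
Proof.
move=> closedU.
have along e j : (j <= k.+1)%N -> (node_at e j \in U) = (inl (src e) \in U).
  elim: j => // j IH jk; rewrite -IH; last exact: ltnW.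
  by have := closedU (e, Ordinal jk); rewrite /link_src /link_tgt /= => <-.
have adjU (u u' : G) : adj u u' -> (inl u \in U) = (inl u' \in U).
  by move=> /adj_edge[e]; have := along e k.+1 (leqnn _);
    rewrite node_at_end => eU [[<- <-]|[<- <-]].
have vertexU (u u' : G) : (inl u \in U) = (inl u' \in U).
  have /connectP[p] := adj_connected u u'.
  elim: p u => [|a p IH] u /=; first by move=> _ ->.
  by move=> /andP[/adjU -> ap] u'E; exact: IH.
have nodeU (z : node) : (z \in U) = (inl (point_vertex G) \in U).
  case: z => [u|[e i]]; first exact: vertexU.
  rewrite -node_at_inner along; first exact: vertexU.
  by rewrite ltnS ltnW.
by rewrite !nodeU.
Qed.

Lemma subdivision_surj (v : node) :
  exists h, end_node link_src link_tgt h = v.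
Proof.
case: v => [v|[e i]].
  have [w /adj_edge[e E]] := neighbour v.
  case: E => -[E1 E2]; first by exists ((e, ord0), false); rewrite /end_node -E1.
  exists ((e, ord_max), true).
  by transitivity (node_at e k.+1); rewrite // node_at_end E2.
exists ((e, widen_ord (leqnSn k) i), true).
exact: node_at_inner.
Qed.

(** Every node is an end of some link. *)
Lemma card_node : (#|node| <= nb_edges G * k.+1 * 2)%N.
Proof.
have -> : (nb_edges G * k.+1 * 2)%N = #|{: link * bool}|.
  by rewrite !card_prod card_ord card_bool.
apply: leq_trans (leq_image_card (end_node link_src link_tgt) _).
apply: subset_leq_card; apply/fintype.subsetP => v _.
have [h <-] := subdivision_surj v; apply: map_f; exact: mem_enum.
Qed.

Definition node_point (v : node) : egraph phi :=
  match v with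
  | inl u => at_vertex phi u
  | inr (e, i) => edge_point phi e (i.+1%:R / k.+1%:R)
  end.

Lemma node_point_at e j : (j <= k.+1)%N ->
  node_point (node_at e j) = edge_point phi e (j%:R / k.+1%:R).
Proof.
case: j => [_|j jk]; first by rewrite mul0r edge_point_le0.
have [jk'|jk'] := ltnP j k; first by rewrite (node_at_inner e (Ordinal jk')).
have -> : j = k by apply/eqP; rewrite eqn_leq jk' andbT -ltnS.
by rewrite node_at_end divff ?pnatr_eq0// edge_point_ge1.
Qed.

(** The position of a half-link on its edge, counted from the source. *)
Definition half_rank (h : link * bool) : nat := (h.1.2.*2 + h.2)%N.

Lemma half_rank_lt h : (half_rank h < (k.+1).*2)%N.
Proof.
apply: (@leq_trans (h.1.2.+1).*2); last by rewrite leq_double.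
by rewrite doubleS /half_rank; case: h.2; rewrite ?addn1 ?addn0 // ltnW.
Qed.

Local Notation M := ((k.+1).*2%:R : R).

Let M_gt0 : 0 < M. Proof. by rewrite ltr0n. Qed.

Definition half_link (h : link * bool) : set (egraph phi) :=
  edge_point phi h.1.1 @`
    `[(half_rank h)%:R / M, (half_rank h).+1%:R / M]%classic.

Lemma half_link_closed h : closed (half_link h).
Proof.
apply: compact_closed; first exact: metric_hausdorff.
apply: continuous_compact; last exact: segment_compact.
by apply: continuous_subspaceT => t; exact: continuous_edge_point.
Qed.

Lemma half_link_measurable h :
  measurable (half_link h : set (borel (egraph phi))).
Proof.
rewrite -[half_link h]setCK; apply: measurableC; apply: sub_gen_smallest.
exact/closed_openC/half_link_closed.
Qed.

Lemma half_link_cover x : exists h, half_link h x.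
Proof.
have [e /on_edgeP[t /andP[t0 t1] ->]] := on_some_edge x.
have [i iM /andP[it ti]] : exists2 i, (i < (k.+1).*2)%N &
    i%:R / M <= t <= i.+1%:R / M.
  move: t1; rewrite le_eqVlt => /predU1P[->|t1].
    (* The integer part of t M is M when t = 1, one beyond the last piece. *)
    exists (k.+1).*2.-1; first by rewrite prednK.
    rewrite prednK// divff ?gt_eqF// lexx andbT.
    by rewrite ler_pdivrMr// mul1r ler_nat leq_pred.
  have tM : 0 <= t * M by rewrite mulr_ge0// ltW.
  have /andP[h1 h2] := truncn_itv tM.
  exists (Num.truncn (t * M)).
    rewrite -(ltr_nat R); apply: le_lt_trans h1 _.
    by rewrite -[ltRHS]mul1r ltr_pM2r.
  by rewrite ler_pdivrMr// h1 ler_pdivlMr// ltW.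
have jk : (i./2 < k.+1)%N by rewrite ltn_half_double.
exists ((e, Ordinal jk), odd i); exists t => //=.
by rewrite in_itv /= /half_rank /= addnC odd_double_half it.
Qed.

Lemma edge_point_inj e e' t t' : 0 < t < 1 ->
  edge_point phi e' t' = edge_point phi e t -> e' = e /\ t' = t.
Proof.
move=> t01 E; have [ct pt] := edge_pointI phi e t01.
have t'01 : 0 < t' < 1.
  apply/andP; split; rewrite ltNge; apply/negP => h.
    by move: ct; rewrite -E edge_point_le0.
  by move: ct; rewrite -E edge_point_ge1.
have [ct' pt'] := edge_pointI phi e' t'01.
have ee : e' = e by apply: (@inr_inj G); rewrite -ct -ct' E.
split => //; have : edge_segment phi e t - edge_segment phi e t' = 0.
  by rewrite -pt -E pt' ee subrr.
rewrite edge_segmentB => /eqP; rewrite scaler_eq0 subr_eq0 => /orP[/eqP//|].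
by rewrite -enorm_eq0 gt_eqF// edge_len_gt0.
Qed.

(** Half-links overlap in end points only, so the interior of a half-link is not
    lost to another piece, whatever rule selects among the pieces. *)
Lemma half_link_interior h h' t :
  (half_rank h)%:R / M < t < (half_rank h).+1%:R / M ->
  half_link h' (edge_point phi h.1.1 t) -> h' = h.
Proof.
move=> /andP[ht th] [t' /= + E].
have t01 : 0 < t < 1.
  rewrite (le_lt_trans _ ht) ?divr_ge0//= (lt_le_trans th)//.
  by rewrite ler_pdivrMr// mul1r ler_nat half_rank_lt.
have [ee ->] := edge_point_inj t01 E.
rewrite in_itv /= => /andP[h't th'].
have rr : half_rank h' = half_rank h.
  apply/eqP; rewrite eqn_leq.
  rewrite -ltnS -(ltr_nat R) -(ltr_pM2r (x := M^-1)) ?invr_gt0//.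
  rewrite (le_lt_trans h't th) /= -ltnS -(ltr_nat R).
  by rewrite -(ltr_pM2r (x := M^-1)) ?invr_gt0// (lt_le_trans ht th').
case: h h' ee rr {ht th h't th' E} => [[e j] b] [[e' j'] b'] /= ->.
rewrite /half_rank /= => rr.
have bb : b' = b by have := congr1 odd rr; rewrite !oddD !odd_double !oddb.
rewrite bb; congr ((_, _), _); apply: val_inj => /=.
by move: rr; rewrite bb => /addIn /double_inj.
Qed.

(** Stated for any rule g that selects among the pieces containing a point: end
    points, where g is arbitrary, carry no length. *)
Lemma half_link_uniform_mass (g : egraph phi -> link * bool) h :
  (forall x, half_link (g x) x) ->
  measurable (g @^-1` [set h] : set (borel (egraph phi))) ->
  (((nb_edges G)%:R^-1 / M)%:E <= uniform_measure phi (g @^-1` [set h]))%E.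
Proof.
move=> gP mg; rewrite /uniform_measure EFinM.
apply: lee_wpmul2l; first by rewrite lee_fin invr_ge0.
rewrite (bigD1 h.1.1)//=.
apply: (@le_trans _ _ (lebesgue_measure
    (`](half_rank h)%:R / M, (half_rank h).+1%:R / M[%classic : set R))).
  rewrite lebesgue_measure_itv /= lte_fin ltr_pM2r ?invr_gt0// ltr_nat ltnSn.
  by rewrite -EFinB -mulrBl -natrB// subSnn mul1r.
apply: (@le_trans _ _ (lebesgue_measure
  (`[0%R, 1%R]%classic `&` edge_point phi h.1.1 @^-1` (g @^-1` [set h])))).
  apply: le_measure; rewrite ?inE.
  - exact: measurable_itv.
  - apply: measurableI; first exact: measurable_itv.
    by rewrite -[X in measurable X]setTI; exact: measurable_edge_point.
  move=> t /=; rewrite in_itv /= => ht; split.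
    move/andP: ht => [ht th]; rewrite in_itv /=.
    rewrite (le_trans _ (ltW ht)) ?divr_ge0//= (le_trans (ltW th))//.
    by rewrite ler_pdivrMr// mul1r ler_nat half_rank_lt.
  exact: half_link_interior ht (gP _).
rewrite leeDl//; apply: sume_ge0 => e _; exact: measure_ge0.
Qed.

Lemma half_link_node_dist h x : half_link h x ->
  mdist x (node_point (end_node link_src link_tgt h)) <= (nb_edges G)%:R^-1 / M.
Proof.
move=> [t /= + <-]; rewrite in_itv /= => /andP[ht th].
have -> : end_node link_src link_tgt h = node_at h.1.1 (h.1.2 + h.2).
  by case: h {ht th} => [[e j] []]; rewrite /end_node /= ?addn1 ?addn0.
rewrite node_point_at; last first.
  by case: h {ht th} => [[e j] []] /=; rewrite ?addn1 ?addn0 // ltnW.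
apply: le_trans (edge_point_lipschitz _ _ _ _) _.
rewrite mulrC ler_wpM2l ?invr_ge0//.
have ME : M = 2 * k.+1%:R by rewrite -muln2 natrM mulrC.
have -> : (h.1.2 + h.2)%:R / k.+1%:R = (h.1.2.*2 + h.2 * 2)%:R / M.
  have K0 : k.+1%:R != 0 :> R by rewrite pnatr_eq0.
  rewrite ME -muln2 -mulnDl natrM; move: (k.+1%:R) K0 => K0 K00; by field.
rewrite ler_distl; move: ht th; rewrite /half_rank; move: (M^-1) => u.
rewrite -[(_ + h.2).+1]addn1 !natrD natrM.
by case: h.2 => /=; rewrite ?mulr1n ?mulr0n; lra.
Qed.

Lemma link_length d :
  mdist (node_point (link_src d)) (node_point (link_tgt d)) <=
  2 * ((nb_edges G)%:R^-1 / M).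
Proof.
rewrite /link_src /link_tgt !node_point_at//; last by rewrite ltnW.
apply: le_trans (edge_point_lipschitz _ _ _ _) _.
have ME : M = 2 * k.+1%:R by rewrite -muln2 natrM mulrC.
rewrite distrC -mulrBl -natrB// subSnn ger0_norm ?divr_ge0//.
have m_gt0 := nb_edgesR_gt0 R G.
have K0 : k.+1%:R != 0 :> R by rewrite pnatr_eq0.
rewrite ME le_eqVlt; apply/orP; left; apply/eqP.
by move: (k.+1%:R) K0 => K0 K00; field; rewrite K00 gt_eqF.
Qed.

End subdivision.

(** * Choice of the subdivision *)

(** From x to a point y of a neighbouring cell one travels at most h to the node
    of x, 2 h along a link, and h to y. *)
Lemma subdivided_disintegrable (R : realType) (G : cgraph) (phi : embedding R G)
    (mu : probability (borel (egraph phi)) R) (f : egraph phi -> R)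
    (c eps r delta : R) (n k : nat) :
  let h := (nb_edges G)%:R^-1 / (k.+1).*2%:R in
  has_density mu (uniform_measure phi) f -> 0 <= c -> (forall x, c <= f x) ->
  (0 < n)%N -> 0 < delta <= 3/80 -> delta <= c * h -> 4 * h <= r ->
  (nb_edges G * k.+1 * 2)%:R * (2 * expR (- (4/3 * (n%:R * delta ^+ 2))))
    <= eps ->
  disintegrable mu n eps r.
Proof.
move=> h mu_f c_ge0 cf n_gt0 delta01 delta_le h_le eps_ge d Psi P X X_iid.
have [g [gP mg]] := measurable_cover_selection
  (@half_link_measurable R G phi k) (@half_link_cover R G phi k).
have g_ge q : delta <= fiber_mass mu g q.
  apply: le_trans delta_le _; rewrite -lee_fin fiber_massE// EFinM.
  apply: le_trans (density_ge mu_f c_ge0 cf (mg q)).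
  by apply: lee_wpmul2l; [rewrite lee_fin|exact: half_link_uniform_mass].
have near_dist x y : one_step (@link_src G k) (@link_tgt G k)
    (cell_of (@link_src G k) (@link_tgt G k) g y)
    (cell_of (@link_src G k) (@link_tgt G k) g x) ->
  mdist x y <= r.
  move=> yx; apply: le_trans h_le.
  have dx := half_link_node_dist (gP x); have := half_link_node_dist (gP y).
  rewrite metric_sym; move: dx yx; rewrite -/h /cell_of.
  set u := end_node _ _ (g x); set v := end_node _ _ (g y) => dx vu dy.
  have duv : mdist (node_point phi u) (node_point phi v) <= 2 * h.
    case: vu => [->|[l [[<- <-]|[<- <-]]]].
    - by rewrite mdistxx mulr_ge0// divr_ge0.
    - by rewrite metric_sym; exact: link_length.
    - exact: link_length.
  have := metric_triangle x (node_point phi u) y.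
  have := metric_triangle (node_point phi u) (node_point phi v) y.
  lra.
have [A [mA PA AP]] := sampled_network_disintegration
  (@subdivision_connected G k) mg (@subdivision_surj G k)
  X_iid n_gt0 delta01 g_ge.
exists A; split => //.
  apply: le_trans PA; rewrite lee_fin lerB//; apply: le_trans eps_ge.
  rewrite ler_wpM2r ?mulr_ge0 ?expR_ge0// ler_nat; exact: card_node.
move=> w /AP[nu [nu1 nu2]]; exists nu; split => // i.
by apply: nu1 => y; exact: near_dist.
Qed.

Section parameters.
Context (R : realType).

Lemma expR_half_le2 : expR (1/2) <= 2 :> R.
Proof.
rewrite -[expR _]invrK invf_ple ?posrE ?invr_gt0 ?expR_gt0// -expRN.
by apply: le_trans (expR_ge1Dx _); lra.
Qed.

(** Equality holds at m = 1, thanks to 0 ^ 0 = 1. *)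
Lemma exp2_le_edge_power m : (0 < m)%N -> (2 ^ m.-1 <= (m * m.-1) ^ m.-1)%N.
Proof.
case: m => [//|[|m _]]; first by [].
by rewrite leq_exp2r// (@leq_trans (2 * 1))// leq_mul.
Qed.

(** With e the root in the radius and s = ln n, eps < 1 forces
    m <= (1 + 2 alpha) s, so that m e = O(s^(3/2) / n^(1/2)) is small compared to
    c for large n.  Then x = c / (2 m e), the ideal number of links per edge, is
    large, and rounding it up to an integer shrinks c h from e to no less than
    7/8 e = delta.  The Chernoff exponent still suffices, because
    4/3 (7/8)^2 = 49/48 >= 1. *)
Lemma choice_of_parameters (c alpha : R) : 0 < c -> 0 < alpha -> c <= 1 ->
  exists n0 : nat, forall n m : nat, (n0 <= n)%N -> (0 < m)%N ->
    let eps := ((m * m.-1) ^ m.-1)%:R * n%:R `^ (- alpha) in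
    eps < 1 ->
    exists (k : nat) (delta : R),
      let h := m%:R^-1 / (k.+1).*2%:R in
      [/\ 0 < delta <= 3/80, delta <= c * h, 4 * h <= disint_radius c alpha n &
          (m * k.+1 * 2)%:R * (2 * expR (- (4/3 * (n%:R * delta ^+ 2)))) <= eps].
Proof.
move=> c_gt0 alpha_gt0 c_le1.
pose B := 24 * 40 ^+ 2 * ((1 + 2 * alpha) ^+ 2 * (2 + alpha)) / c ^+ 2.
have B_ge0 : 0 <= B.
  by rewrite divr_ge0 ?sqr_ge0// mulr_ge0// mulr_ge0 ?sqr_ge0//; lra.
exists (Num.truncn (expR (2 + B))).+1 => n m n_ge m_gt0 eps eps_lt1.
have n_exp : expR (2 + B) <= n%:R.
  have /andP[_ /ltW h] := truncn_itv (expR_ge0 (2 + B)).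
  by apply: le_trans h _; rewrite ler_nat.
have n_ge3 : 3 <= n%:R :> R.
  by apply: le_trans n_exp; apply: le_trans (expR_ge1Dx _); lra.
have n_gt0 : 0 < n%:R :> R by lra.
set s := ln n%:R : R.
have nE : n%:R = expR s by rewrite lnK.
have s_ge : 2 + B <= s by rewrite -ler_expR -nE.
have s_gt0 : 0 < s by lra.
(* Any power of s beyond 3 would do: 40 m e <= c is a bound on s^3 / n. *)
have n_ge_s4 : s ^+ 4 / 24 <= n%:R.
  have := expR_ge1Dxn 3 (ltW s_gt0); rewrite -nE (_ : 4`!%:R = 24)//; lra.
have powE : n%:R `^ (- alpha) = expR (- alpha * s).
  by rewrite nE -expRM mulrC.
have m_gt0R : 1 <= m%:R :> R by rewrite ler1n.
have m_le : m%:R <= (1 + 2 * alpha) * s.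
  have : expR (m.-1%:R * (1/2)) < expR (alpha * s) :> R.
    rewrite expRM_natl; apply: (@le_lt_trans _ _ (2 ^+ m.-1)).
      by rewrite lerXn2r ?nnegrE ?expR_ge0 ?expR_half_le2.
    apply: (@le_lt_trans _ _ ((m * m.-1) ^ m.-1)%:R).
      by rewrite -natrX ler_nat exp2_le_edge_power.
    rewrite -(@ltr_pM2r _ (expR (- alpha * s))) ?expR_gt0// -powE -/eps powE.
    by rewrite -expRD mulNr subrr expR0.
  rewrite ltr_expR => h; have mE : m%:R = m.-1%:R + 1 :> R.
    by rewrite natr1 prednK.
  nra.
pose e : R := Num.sqrt ((2 + alpha) * (s / n%:R)).
have e2 : e ^+ 2 = (2 + alpha) * (s / n%:R).
  by rewrite sqr_sqrtr// mulr_ge0 ?divr_ge0//; lra.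
have ne2 : n%:R * e ^+ 2 = (2 + alpha) * s.
  by rewrite e2; field; rewrite gt_eqF.
have e_gt0 : 0 < e by rewrite sqrtr_gt0 mulr_gt0 ?divr_gt0//; lra.
have e_small : 40 * m%:R * e <= c.
  have me_ge0 : 0 <= 40 * m%:R * e by rewrite !mulr_ge0// ltW.
  rewrite -(@ler_pXn2r _ 2)// ?nnegrE ?(ltW c_gt0)//.
  rewrite exprMn e2 mulrA mulrA ler_pdivrMr//.
  have m2 : m%:R ^+ 2 <= ((1 + 2 * alpha) * s) ^+ 2.
    by rewrite lerXn2r// nnegrE ?ler0n// mulr_ge0//; lra.
  have sc : 24 * 40 ^+ 2 * ((1 + 2 * alpha) ^+ 2 * (2 + alpha)) <= s * c ^+ 2.
    by rewrite -ler_pdivrMr ?exprn_gt0// -/B; lra.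
  have h1 : (40 * m%:R) ^+ 2 * (2 + alpha) * s <=
      40 ^+ 2 * ((1 + 2 * alpha) ^+ 2 * (2 + alpha)) * s ^+ 3.
    rewrite [leLHS](_ : _ = 40 ^+ 2 * ((2 + alpha) * s) * m%:R ^+ 2);
      last by ring.
    rewrite [leRHS](_ : _ =
        40 ^+ 2 * ((2 + alpha) * s) * ((1 + 2 * alpha) * s) ^+ 2);
      last by ring.
    by rewrite ler_wpM2l// mulr_ge0// mulr_ge0//; lra.
  have h2 := ler_wpM2l (exprn_ge0 3 (ltW s_gt0)) sc.
  have h3 : c ^+ 2 * s ^+ 4 <= c ^+ 2 * (24 * n%:R).
    by rewrite ler_wpM2l ?sqr_ge0//; lra.
  have : s ^+ 3 * (s * c ^+ 2) = c ^+ 2 * s ^+ 4 by ring.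
  lra.
pose x := c / (2 * m%:R * e).
have m0 : 0 < m%:R :> R by lra.
have me_gt0 : 0 < 2 * m%:R * e by rewrite !mulr_gt0.
have x_ge : 20 <= x by rewrite ler_pdivlMr//; lra.
have x_ge0 : 0 <= x by lra.
exists (Num.truncn x), (7/8 * e).
set k := Num.truncn x; have /andP[kx xk] := truncn_itv x_ge0.
rewrite -/k in kx xk; have kE : k.+1%:R = k%:R + 1 :> R by rewrite natr1.
have K_le : 7 * k.+1%:R <= 8 * x by lra.
set K := k.+1%:R in xk kE K_le *.
have K_gt0 : 0 < K by rewrite ltr0n.
have -> : (k.+1).*2%:R = 2 * K :> R by rewrite -muln2 natrM mulrC.
have xE : x * (2 * m%:R * e) = c by rewrite divfK ?gt_eqF.
split.
- apply/andP; split; first by rewrite mulr_gt0.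
  nra.
- have -> : c * (m%:R^-1 / (2 * K)) = (x / K) * e.
    by rewrite -xE; field; rewrite !gt_eqF.
  rewrite ler_pM2r// ler_pdivlMr//; lra.
- have -> : disint_radius c alpha n = 4 * (c^-1 * e).
    by rewrite [RHS]mulrA.
  rewrite ler_pM2l// -xE.
  have -> : (x * (2 * m%:R * e))^-1 * e = m%:R^-1 / (2 * x).
    by field; rewrite !gt_eqF//; lra.
  rewrite ler_pM2l ?invr_gt0// lef_pV2 ?posrE; lra.
have expE : expR (- (4/3 * (n%:R * (7/8 * e) ^+ 2))) <=
    (n%:R ^+ 2)^-1 * n%:R `^ (- alpha).
  rewrite powE nE -expRM_natl -expRN -expRD ler_expR -nE.
  have -> : n%:R * (7/8 * e) ^+ 2 = 49/64 * ((2 + alpha) * s).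
    by rewrite -ne2; field.
  nra.
apply: (@le_trans _ _ (n%:R `^ (- alpha))); last first.
  rewrite ler_peMl ?powR_ge0// ler1n.
  by apply: leq_trans (exp2_le_edge_power m_gt0); rewrite expn_gt0.
have count_le : (m * k.+1 * 2)%:R * 2 <= n%:R ^+ 2 :> R.
  have en : 1 <= e * n%:R.
    rewrite -(@ler_pXn2r _ 2)// ?nnegrE ?mulr_ge0 ?(ltW e_gt0)// expr1n exprMn e2.
    have -> : (2 + alpha) * (s / n%:R) * n%:R ^+ 2 = (2 + alpha) * s * n%:R.
      by field; rewrite gt_eqF.
    nra.
  have mx_le : m%:R * x <= n%:R / 2.
    have := ler_wpM2l (mulr_ge0 (ltW m0) x_ge0) en.
    rewrite mulr1 => /le_trans; apply.
    have -> : m%:R * x * (e * n%:R) = c / 2 * n%:R by rewrite -xE; field.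
    rewrite mulrC ler_pM2l//; lra.
  have mK_le : 7 * (m%:R * K) <= 8 * (m%:R * x).
    by have := ler_wpM2l (ltW m0) K_le; lra.
  have n2 : 3 * n%:R <= n%:R ^+ 2 :> R by rewrite expr2 ler_pM2r.
  rewrite !natrM -/K; lra.
apply: (@le_trans _ _ ((m * k.+1 * 2)%:R *
    (2 * ((n%:R ^+ 2)^-1 * n%:R `^ (- alpha))))).
  by rewrite ler_wpM2l// ler_wpM2l.
rewrite !mulrA -[leRHS]mul1r ler_wpM2r ?powR_ge0//.
by rewrite ler_pdivrMr ?exprn_gt0// mul1r.
Qed.

End parameters.

Theorem theorem4p8 (R : realType) (c C alpha : R)
    (c_gt0 : 0 < c) (c_le_C : c <= C) (alpha_gt0 : 0 < alpha) :
  exists n0 : nat,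
    forall (G : cgraph) (phi : embedding R G)
      (mu : probability (borel (egraph phi)) R) (f : egraph phi -> R),
      has_density mu (uniform_measure phi) f ->
      (forall x : egraph phi, c <= f x <= C) ->
      forall n : nat, (0 < n)%N -> (n0 <= n)%N ->
        disintegrable mu n
          (((nb_edges G * (nb_edges G).-1) ^ (nb_edges G).-1)%:R
             * n%:R `^ (- alpha))
          (disint_radius c alpha n).
Proof.
have [c_le1|c_gt1] := leP c 1; last first.
  (* No probability has a density bounded below by c > 1. *)
  exists 0%N => G phi mu f mu_f f_bd; exfalso.
  have c_le_f x : c <= f x by case/andP: (f_bd x).
  have : (c%:E * uniform_measure phi setT <= mu setT)%E.
    exact: density_ge mu_f (ltW c_gt0) c_le_f measurableT.
  rewrite (probability_setT mu) (probability_setT (uniform_measure phi)).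
  by rewrite mule1 lee_fin leNgt c_gt1.
have [n0 n0P] := choice_of_parameters c_gt0 alpha_gt0 c_le1.
exists n0 => G phi mu f mu_f f_bd n n_gt0 n_ge.
set eps := _%:R * _.
have [eps_ge1|eps_lt1] := leP 1 eps.
  move=> d Psi P X _; exists set0; split => //.
  by rewrite measure0 lee_fin subr_le0.
have [k [delta [delta01 delta_le h_le err_le]]] :=
  n0P n _ n_ge (nb_edges_gt0 G) eps_lt1.
apply: (subdivided_disintegrable mu_f (ltW c_gt0) _ n_gt0
  delta01 delta_le h_le err_le).
by move=> x; case/andP: (f_bd x).
Qed.
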